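(* Let $k\ge 2$, let $r_{ij}=r_{ji}$ ($1\le i\neq j\le k$) be positive integers, let $\Pi(r_{12},\dots,r_{k-1\,k})$ be the Gale dual type-A root polytope, and let $p(n,t)=1+t+t^2+\dots+t^{n-1}$. For a nonempty subset $J\subset\{2,\dots,k\}$ let $\overline J=\{1,\dots,k\}\setminus J$, and let $\Pi(r_{ij\in\overline J})$ be the Gale dual root polytope corresponding to the root system $A_{|\overline J|-1}$ defined by the sequence of vectors $\alpha_{ij}$, $i\ne j\in\overline J$, with $\alpha_{ij}$ repeated $r_{ij}$ times. Then $$g(\Pi(r_{12},\dots,r_{k-1\,k}),t)=\sum_{\substack{J\subset\{2,\dots,k\}\\ J\ne\emptyset}}(-1)^{|J|-1}\,g(\Pi(r_{ij\in\overline J}),t)\cdot\prod_{j\in J}p\Big(\sum_{i\in\overline J}r_{ij},\,t\Big).$$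
   Context: **Polytope.** For a finite set $V$ with $|V|\ge2$ and positive integers $r_{ij}=r_{ji}$ ($i\neq j\in V$), let $\alpha_{ij}=\varepsilon_i-\varepsilon_j\in\mathbb R^V$, and let $\mathfrak A=[\alpha_1,\dots,\alpha_n]$ be the sequence in which each $\alpha_{ij}$ (for every ordered pair $i\neq j$ in $V$) is repeated $r_{ij}$ times, $n=2\sum_{\{i,j\}\subset V}r_{ij}$, $d=n-|V|+1$. Let $\mathfrak t$ be the dual of the $d$-dimensional space $\mathfrak t^*=\{m\in\mathbb R^n:\sum_i m_i\alpha_i=0\}$, and let $\beta_i\in\mathfrak t$ be the functional $m\mapsto m_i$. The Gale dual type-A root polytope of these data is the convex hull of $\beta_1,\dots,\beta_n$, a polytope of dimension $d-1$. $\Pi(r_{12},\dots,r_{k-1\,k})$ is the case $V=\{1,\dots,k\}$ and $\Pi(r_{ij\in\overline J})$ the case $V=\overline J$. Convention: if $|\overline J|=1$, then $g(\Pi(r_{ij\in\overline J}),t)=1$. **$g$- and $h$-polynomials (Stanley).** For convex polytopes define inductively: $g(\emptyset,t)=h(\emptyset,t)=1$, $\dim\emptyset=-1$; for a polytope $P$ of dimension $D\ge 0$, $$h(P,t)=\sum_{F<P}g(F,t)(t-1)^{D-1-\dim F},$$ the sum over all proper faces $F$ of $P$ including the empty face; writing $h(P,t)=\sum_{i=0}^D h_it^i$, set $g(P,t)=h_0+\sum_{i=1}^{\lfloor D/2\rfloor}(h_i-h_{i-1})t^i$. *)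

(* Defs.v *)
From HB Require Import structures.
From mathcomp Require Import all_boot all_order all_algebra.
From mathcomp Require Import all_classical reals.

Set Implicit Arguments.
Unset Strict Implicit.
Unset Printing Implicit Defensive.

Import Order.TTheory GRing.Theory Num.Theory.

Local Open Scope classical_set_scope.
Local Open Scope ring_scope.

Section Polytope.
Variables (R : realType) (T : vectType R).
Implicit Types P F : set T.

Definition conv_hull (I : finType) (v : I -> T) : set T :=
  [set x | exists w : I -> R,
     [/\ forall i, 0 <= w i, \sum_i w i = 1 & x = \sum_i w i *: v i]].

(* The functional [l] may be 0, so that [set0] and [P] are faces of [P]. *)
Definition is_face P F : Prop :=
  exists (l : 'Hom(T, R^o)) (c : R),
    (forall x, P x -> l x <= c) /\ F = P `&` [set x | l x = c].

Definition proper_faces P : set (set T) := [set F | is_face P F /\ F <> P].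

Definition has_directions P (U : {vspace T}) : Prop :=
  forall x y, P x -> P y -> x - y \in U.

(* The direction of the affine hull of [P]: the least linear subspace containing
   the differences of points of [P], which exists by [dirspaceP] below. *)
Definition dirspace P : {vspace T} :=
  xget 0%VS [set U | has_directions P U /\
                     forall W, has_directions P W -> (U <= W)%VS].

Definition pdim P : int := if P == set0 then - 1 else (\dim (dirspace P))%:Z.

(* For a proper face [F] the exponent [pdim P - 1 - pdim F] is nonnegative, so
   that the absolute value only serves as a cast to [nat].  A finitely supported
   sum over an infinite support would be 0, but a polytope has finitely many
   faces ([finite_faces]). *)
Definition face_sum (g : set T -> {poly int}) P : {poly int} :=
  \sum_(F \in proper_faces P) g F * ('X - 1) ^+ absz (pdim P - 1 - pdim F)%R.

Definition g_of_h (D : nat) (h : {poly int}) : {poly int} :=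
  (h`_0)%:P + \sum_(1 <= i < (D./2).+1) (h`_i - h`_i.-1) *: 'X^i.

(* The recursion is on a bound [n] for [pdim P + 1], as proper faces have
   smaller dimension; [gpolyE] and [hpolyE] are the defining equations. *)
Fixpoint gpoly_rec (n : nat) P : {poly int} :=
  if n is m.+1 then
    if P == set0 then 1 else g_of_h (absz (pdim P)) (face_sum (gpoly_rec m) P)
  else 1.

Definition gpoly P : {poly int} := gpoly_rec (absz (pdim P + 1)%R) P.

Definition hpoly P : {poly int} := if P == set0 then 1 else face_sum gpoly P.

Lemma dirspaceP P : has_directions P (dirspace P) /\
  forall W, has_directions P W -> (dirspace P <= W)%VS.
Proof.
have hI U W : has_directions P U -> has_directions P W ->
  has_directions P (U :&: W)%VS.
  by move=> hU hW x y Px Py; rewrite memv_cap hU // hW.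
have ex : exists n, `[< exists2 U, has_directions P U & \dim U = n >].
  exists (\dim {:T}); apply/asboolP; exists fullv => //.
  by move=> x y _ _; rewrite memvf.
case: (ex_minnP ex) => n /asboolP[U hU <-] Umin.
have hm : [set U | has_directions P U /\
    forall W, has_directions P W -> (U <= W)%VS] U.
  split=> // W hW; apply/capv_idPl/eqP.
  rewrite eqEdim capvSl /=; apply: Umin; apply/asboolP.
  by exists (U :&: W)%VS => //; exact: hI.
by rewrite /dirspace; case: xgetP => [V _ //|/(_ U)].
Qed.

Lemma pdim_face P F : proper_faces P F -> pdim F < pdim P.
Proof.
move=> [[l [c [lP eF]]] nFP].
have sFP : F `<=` P by rewrite eF => x [].
have [x Px lx] : exists2 x, P x & l x != c.
  apply: contrapT => nx; apply: nFP; rewrite eF; apply/seteqP; split=> [y []//|y Py].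
  by split=> //=; apply/eqP; apply: contrapT => /negP ny; apply: nx; exists y.
have /eqP/negPf P0 : P <> set0 by move=> P0; move: Px; rewrite P0.
rewrite /pdim P0; case: eqP => [//|/eqP/set0P[y Fy]].
have [dP _] := dirspaceP P; have [_ dF] := dirspaceP F.
have sd : (dirspace F <= dirspace P)%VS.
  by apply: dF => u v /sFP Pu /sFP Pv; exact: dP.
have sk : (dirspace F <= lker l)%VS.
  apply: dF => u v; rewrite eF => -[_ /= lu] [_ /= lv].
  by rewrite memv_ker linearB /= lu lv subrr.
have ly : l y = c by move: Fy; rewrite eF => -[].
rewrite ltz_nat ltnNge; apply/negP => le.
have eq : dirspace F = dirspace P by apply/eqP; rewrite eqEdim sd le.
have : x - y \in lker l by apply: (subvP sk); rewrite eq dP //; exact: sFP.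
by rewrite memv_ker linearB /= ly subr_eq0 (negPf lx).
Qed.

Lemma pdim_set0 : pdim set0 = - 1. Proof. by rewrite /pdim eqxx. Qed.

Lemma pdim1_ge0 P : 0 <= pdim P + 1.
Proof. by rewrite /pdim; case: ifP. Qed.

Lemma gpoly_rec_fuel P (n : nat) : pdim P + 1 <= n%:Z -> gpoly_rec n P = gpoly P.
Proof.
have H m : forall Q (k : nat), pdim Q + 1 <= m%:Z -> pdim Q + 1 <= k%:Z ->
    gpoly_rec m Q = gpoly_rec k Q.
  elim: m => [|m IH] Q k.
    rewrite /pdim; case: k => [//|k] /=; case: eqP => // _.
    by rewrite lezD1.
  case: k => [_|k hm hk] /=.
    rewrite /pdim; case: eqP => // _.
    by rewrite lezD1.
  case: eqP => // _; congr g_of_h; apply: eq_fsbigr => F; rewrite inE => pF.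
  have lt := pdim_face pF; congr (_ * _); apply: IH.
    by rewrite lezD1 (lt_le_trans lt) // -(lerD2r 1) -PoszD addn1.
  by rewrite lezD1 (lt_le_trans lt) // -(lerD2r 1) -PoszD addn1.
by move=> hn; apply: H => //; rewrite gez0_abs ?pdim1_ge0.
Qed.

Lemma gpoly0 : gpoly set0 = 1.
Proof. by rewrite /gpoly pdim_set0. Qed.

Lemma hpolyE P : P <> set0 ->
  hpoly P = \sum_(F \in proper_faces P)
              gpoly F * ('X - 1) ^+ absz (pdim P - 1 - pdim F)%R.
Proof. by rewrite /hpoly; case: eqP. Qed.

Lemma gpolyE P : P <> set0 -> gpoly P = g_of_h (absz (pdim P)) (hpoly P).
Proof.
move=> P0; rewrite (hpolyE P0).
have dP : 0 <= pdim P by rewrite /pdim; case: eqP.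
rewrite /gpoly -[X in absz (X + 1)%R]gez0_abs // -PoszD addn1 /=.
case: eqP => // _; congr g_of_h; apply: eq_fsbigr => F; rewrite inE => pF.
by rewrite gpoly_rec_fuel // lezD1 gez0_abs // pdim_face.
Qed.

Lemma finite_faces (I : finType) (v : I -> T) :
  finite_set (proper_faces (conv_hull v)).
Proof.
pose f (A : {set I}) : set T := [set x | exists w : I -> R,
  [/\ forall i, 0 <= w i, \sum_i w i = 1, forall i, i \notin A -> w i = 0
    & x = \sum_i w i *: v i]].
apply: (@sub_finite_set _ _ (range f)); last exact: finite_image.
move=> F [[l [c [lP ->]]] _]; exists [set i | l (v i) == c]%SET => //.
have hv i : l (v i) <= c.
  apply: lP; exists (fun j => (j == i)%:R); split=> [j||].
  - exact: ler0n.
  - by rewrite (bigD1 i) //= eqxx big1 ?addr0 // => j /negPf ->.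
  - rewrite (bigD1 i) //= eqxx scale1r big1 ?addr0 // => j /negPf ->.
    by rewrite scale0r.
have key (w : I -> R) : \sum_i w i = 1 ->
    c - l (\sum_i w i *: v i) = \sum_i w i * (c - l (v i)).
  move=> w1; rewrite linear_sum /= -[c in LHS]mul1r -w1 mulr_suml -sumrB.
  by apply: eq_bigr => i _; rewrite linearZ /= mulrBr.
apply/seteqP; split=> x [].
  move=> w [w0 w1 wA ->]; split; first by exists w.
  apply/esym/eqP; rewrite /= -subr_eq0 key // big1 // => i _.
  have [|/wA ->] := boolP (i \in [set i | l (v i) == c]%SET); last by rewrite mul0r.
  by rewrite inE => /eqP ->; rewrite subrr mulr0.
move=> [w [w0 w1 ->]] /= /esym/eqP; rewrite -subr_eq0 key // => /eqP s0.
exists w; split=> // i; rewrite inE => ni.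
have /(psumr_eq0P (F := fun i => w i * (c - l (v i)))) :
  forall i : I, true -> 0 <= w i * (c - l (v i)).
  by move=> j _; rewrite mulr_ge0 // subr_ge0.
move=> /(_ s0 i isT)/eqP; rewrite mulf_eq0 subr_eq0 [c == _]eq_sym (negPf ni) orbF.
by move/eqP.
Qed.

End Polytope.

Section GaleDual.
Variables (R : realType) (I : finType) (W : vectType R) (a : I -> W).

Definition relations : {vspace {ffun I -> R^o}} :=
  lker (linfun (fun m : {ffun I -> R^o} => \sum_i m i *: a i)).

Definition relations_dual : vectType R := 'Hom(subvs_of relations, R^o).

Definition coord_functional (i : I) : relations_dual :=
  linfun (fun m : subvs_of relations => vsval m i).

Lemma relationsP (m : {ffun I -> R^o}) :
  (m \in relations) = (\sum_i m i *: a i == 0).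
Proof.
pose f (u : {ffun I -> R^o}) := \sum_i u i *: a i.
have fL : linear f.
  move=> c u v; rewrite /f scaler_sumr -big_split /=; apply: eq_bigr => i _.
  by rewrite !ffunE scalerDl scalerA.
pose F := HB.pack f (GRing.isLinear.Build _ _ _ _ f fL) : {linear _ -> _}.
by rewrite memv_ker -[RHS]/(F m == 0) -(lfunE F).
Qed.

Lemma coord_functionalE (i : I) (m : subvs_of relations) :
  (coord_functional i : 'Hom(_, _)) m = vsval m i.
Proof.
pose f (u : subvs_of relations) : R^o := vsval u i.
have fL : linear f by move=> c u v; rewrite /f linearP !ffunE.
pose F := HB.pack f (GRing.isLinear.Build _ _ _ _ f fL) : {linear _ -> _}.
by rewrite -[RHS]/(F m) -(lfunE F).
Qed.

Definition gale_dual : set relations_dual := conv_hull coord_functional.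

End GaleDual.
Arguments coord_functional {R I W} a i.
Arguments gale_dual {R I W} a.

Section RootPolytope.
Variables (R : realType) (V : finType) (r : V -> V -> nat).

(* The triples (i, j, l) with i != j and l < r i j: the positions of the
   sequence of roots in which each alpha_ij is repeated r i j times. *)
Definition root_index : finType :=
  {p : {p : V * V | p.1 != p.2} & 'I_(r (val p).1 (val p).2)}.

Definition basis_vec (i : V) : {ffun V -> R^o} := [ffun x => (x == i)%:R].

Definition root (i j : V) : {ffun V -> R^o} := basis_vec i - basis_vec j.

Definition root_seq (x : root_index) : {ffun V -> R^o} :=
  root (val (tag x)).1 (val (tag x)).2.

Definition root_polytope : set (relations_dual root_seq) := gale_dual root_seq.

Definition groot : {poly int} := if #|V| == 1%N then 1 else gpoly root_polytope.

End RootPolytope.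
Arguments root_polytope R {V} r.
Arguments groot R {V} r.

Definition restrict_mult (V : finType) (r : V -> V -> nat) (A : {set V})
    (i j : {x : V | x \in A}) : nat :=
  r (val i) (val j).

Definition geom_poly (n : nat) : {poly int} := \sum_(i < n) 'X^i.

(* Main.v *)
(* Write z(X) for the dimension of the circulations supported on a set X of arcs
   and cyc X for the set of arcs of X lying on a directed cycle of X.  A face of
   the polytope is cut out by a nonnegative circulation, so it is the convex hull
   F_S of the beta_e with e outside S, for a set S with cyc S = S (the support of
   the circulation), and dim F_S = z(E) - z(S) - 1.  Fix a root vertex 1.  By
   induction on faces,
     g(F_S, t) = G_S := sum of (t - 1)^(z(X) - z(S)) over the arc sets X that reach
   every vertex from 1 and have cyc X = S.  Indeed, grouping the X by cyc X turns
   G_S + (t - 1) h(F_S, t) into the sum of (t - 1)^(z(X) - z(S)) over all X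
   containing S and reaching every vertex; a sign-reversing involution shows that
   this is the reciprocal of G_S, and as an X with cyc X = S contains no two
   opposite arcs outside S, the degrees of G_S are below the truncation bound and
   those of its reciprocal above.
   For S empty the X are the acyclic graphs whose only source is 1, and
   inclusion-exclusion over their sets J of sinks gives the recursion. *)
From HB Require Import structures.
Require Import Defs.
From mathcomp Require Import all_boot all_order all_algebra.
From mathcomp Require boolp classical_sets cardinality fsbigop.
From mathcomp Require Import reals zify.

Set Implicit Arguments.
Unset Strict Implicit.
Unset Printing Implicit Defensive.

Import Order.TTheory GRing.Theory Num.Theory.
Local Open Scope ring_scope.

(** * Reachability and directed cycles *)

Section Digraph.
Variables (V E : finType) (src tgt : E -> V).
Implicit Types (X Y S Z : {set E}) (u v w : V) (C D : {set V}).

Definition adjacent X : rel V :=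
  fun u v => [exists e in X, (src e == u) && (tgt e == v)].

Definition reach X : rel V := connect (adjacent X).

Definition cyc X : {set E} := [set e in X | reach X (tgt e) (src e)].

Definition spanning u X := [forall v, reach X u v].

Lemma adjacentP X u v :
  reflect (exists2 e, e \in X & src e = u /\ tgt e = v) (adjacent X u v).
Proof.
apply: (iffP exists_inP) => [[e eX /andP[/eqP su /eqP tv]]|[e eX [su tv]]].
  by exists e.
by exists e => //; rewrite su tv !eqxx.
Qed.

Lemma adjacent_mem X e : e \in X -> adjacent X (src e) (tgt e).
Proof. by move=> eX; apply/adjacentP; exists e. Qed.

Lemma reach_arc X e : e \in X -> reach X (src e) (tgt e).
Proof. by move=> eX; apply: connect1; apply: adjacent_mem. Qed.

Lemma reach_trans X : transitive (reach X).
Proof. exact: connect_trans. Qed.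

Lemma reach0 X u : reach X u u. Proof. exact: connect0. Qed.

Lemma reach_sub X Y u v : X \subset Y -> reach X u v -> reach Y u v.
Proof.
move=> sXY; apply: connect_sub => a b /adjacentP[e eX [<- <-]].
by apply: reach_arc; apply: (subsetP sXY).
Qed.

Lemma reach_closed X (D : pred V) u v :
  (forall e, e \in X -> D (src e) -> D (tgt e)) ->
  reach X u v -> D u -> D v.
Proof.
move=> cD /connectP[p pth ->]; elim: p u pth => //= w p IH u /andP[uw pth] Du.
by apply: IH => //; case/adjacentP: uw Du => e eX [<- <-]; exact: cD.
Qed.

Lemma spanningP u X : reflect (forall v, reach X u v) (spanning u X).
Proof. exact: forallP. Qed.

Lemma spanning_sub u X Y : X \subset Y -> spanning u X -> spanning u Y.
Proof.
by move=> sXY /spanningP RX; apply/spanningP => v; apply: reach_sub (RX v).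
Qed.

Lemma mem_cyc X e : (e \in cyc X) = (e \in X) && reach X (tgt e) (src e).
Proof. by rewrite inE. Qed.

Lemma cyc_sub X : cyc X \subset X.
Proof. by apply/subsetP => e; rewrite mem_cyc => /andP[]. Qed.

Lemma cyc_mono X Y : X \subset Y -> cyc X \subset cyc Y.
Proof.
move=> sXY; apply/subsetP => e; rewrite !mem_cyc => /andP[eX re].
by rewrite (subsetP sXY) // (reach_sub sXY).
Qed.

(** A directed cycle through [e] in [X] consists of arcs lying on that same cycle, so it survives in
    [cyc X]. The induction along the way back from [tgt e] keeps track of the vertices that still
    reach [src e]. *)
Lemma cyc_id X : cyc (cyc X) = cyc X.
Proof.
apply/eqP; rewrite eqEsubset cyc_sub /=; apply/subsetP => e eX.
rewrite mem_cyc eX /=; have := eX; rewrite mem_cyc => /andP[eX' re].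
pose D v := reach X v (src e) ==> reach (cyc X) (tgt e) v.
have: D (src e).
  apply: (reach_closed _ re); last by rewrite /D reach0 implybT.
  move=> f fX; rewrite /D => /implyP H; apply/implyP => tf.
  have sf : reach X (src f) (src e) by apply: reach_trans tf; apply: reach_arc.
  apply: reach_trans (H sf) _; apply: reach_arc; rewrite mem_cyc fX /=.
  apply: reach_trans tf _; apply: reach_trans (reach_arc eX') _.
  by apply: reach_sub (H sf); exact: cyc_sub.
by rewrite /D reach0.
Qed.

(** Each arc of [S] has a return path in [S], so a walk can be undone arc by arc: the components of
    such an [S] are strongly connected. *)
Lemma cyc_reach_sym S u v : cyc S = S -> reach S u v -> reach S v u.
Proof.
move=> cS ruv; apply: (reach_closed (D := fun w => reach S w u) _ ruv).
  move=> e eS se; apply: reach_trans se.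
  by move: eS; rewrite -{1}cS mem_cyc => /andP[].
exact: reach0.
Qed.

Lemma reach_setD1 X e u v : reach X u v ->
  reach (X :\ e) u v || (reach (X :\ e) u (src e) && reach (X :\ e) (tgt e) v).
Proof.
move=> ruv.
pose D w := reach (X :\ e) u w ||
  (reach (X :\ e) u (src e) && reach (X :\ e) (tgt e) w).
apply: (reach_closed (D := D) _ ruv); last by rewrite /D reach0.
move=> f fX; rewrite /D; have [->|nfe] := eqVneq f e.
  by case/orP=> [->|/andP[-> _]]; rewrite reach0 orbT.
have rf : reach (X :\ e) (src f) (tgt f) by rewrite reach_arc // !inE nfe.
case/orP=> [r1|/andP[r1 r2]]; first by rewrite (reach_trans r1 rf).
by rewrite r1 (reach_trans r2 rf) orbT.
Qed.

(** A new directed cycle would pass through [e], and the rest of it would be a return path in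
    [X]. *)
Lemma cyc_setU1 X e : ~~ reach X (tgt e) (src e) -> cyc (e |: X) = cyc X.
Proof.
move=> ne.
have sub u v : reach ((e |: X) :\ e) u v -> reach X u v.
  by apply: reach_sub; apply/subsetP => f; rewrite !inE => /andP[/negPf->].
apply/eqP; rewrite eqEsubset [X in _ && X]cyc_mono ?subsetUr // andbT.
apply/subsetP => f; rewrite !mem_cyc in_setU1 => /andP[/orP[/eqP->|fX] rf].
  by case/orP: (reach_setD1 e rf) => [|/andP[]] /sub; rewrite (negPf ne).
rewrite fX /=; case/orP: (reach_setD1 e rf) => [/sub//|/andP[/sub r1 /sub r2]].
by case/negP: ne; apply: reach_trans r2 _; apply: reach_trans (reach_arc fX) r1.
Qed.

Lemma spanning_exit u X (D : pred V) : spanning u X -> D u ->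
  ~~ [forall v, D v] -> exists2 e, e \in X & D (src e) && ~~ D (tgt e).
Proof.
move=> /spanningP RX Du; rewrite negb_forall => /existsP[v nDv].
have [/exists_inP//|nex] := boolP [exists e in X, D (src e) && ~~ D (tgt e)].
case/negP: nDv; apply: (reach_closed _ (RX v) Du) => e eX se.
apply: contraR nex => te; apply/exists_inP; exists e => //.
by rewrite se te.
Qed.

End Digraph.

(** * Circulations *)

Section Circulations.
Variables (R : realType) (V E : finType) (src tgt : E -> V).
Implicit Types (X Y S Z : {set E}) (u v w : V) (D : pred V).
Implicit Types (m f : {ffun E -> R^o}).

Local Notation reach := (reach src tgt).
Local Notation cyc := (cyc src tgt).
Local Notation spanning := (spanning src tgt).

Definition arc_root (e : E) : {ffun V -> R^o} := Defs.root R (src e) (tgt e).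

Definition outside X m : {ffun E -> R^o} := [ffun e => if e \in X then 0 else m e].

Definition supported X : {vspace {ffun E -> R^o}} := lker (linfun (outside X)).

Lemma supportedP X m :
  reflect (forall e, e \notin X -> m e = 0) (m \in supported X).
Proof.
have fL : linear (outside X).
  move=> c u v; apply/ffunP => e; rewrite !ffunE.
  by case: ifP => // _; rewrite scaler0 addr0.
pose F := HB.pack (outside X) (GRing.isLinear.Build _ _ _ _ (outside X) fL) : {linear _ -> _}.
rewrite memv_ker (lfunE F) /=; apply: (iffP eqP) => [/ffunP H e /negPf nX|H].
  by have := H e; rewrite !ffunE nX.
by apply/ffunP => e; rewrite !ffunE; case: ifPn => // /H.
Qed.

Definition circ X : {vspace {ffun E -> R^o}} := (relations arc_root :&: supported X)%VS.

(** This is [z(X)]. Circulations may be negative, so it is the cycle rank of the underlying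
    undirected multigraph. *)
Definition nullity X : nat := \dim (circ X).

Lemma circP X m :
  reflect (\sum_e m e *: arc_root e = 0 /\ forall e, e \notin X -> m e = 0)
          (m \in circ X).
Proof.
rewrite memv_cap relationsP; apply: (iffP andP) => [[/eqP ? /supportedP]|[/eqP ? ?]] //.
by split => //; apply/supportedP.
Qed.

Lemma circ_sub X Y : X \subset Y -> (circ X <= circ Y)%VS.
Proof.
move=> sXY; apply/subvP => m /circP[m0 mX]; apply/circP; split=> // e nY.
by apply: mX; apply: contra nY; exact: (subsetP sXY).
Qed.

Lemma circ_setT : circ [set: E] = relations arc_root.
Proof.
apply/vspaceP => m; rewrite memv_cap; case: (m \in relations _) => //=.
by apply/supportedP => e; rewrite inE.
Qed.

(** The net flow out of a vertex set is zero: adding the coordinates of the relation over [D] leaves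
    only the arcs crossing the boundary of [D]. *)
Lemma circ_cut X m D : m \in circ X ->
  \sum_e m e * ((D (src e))%:R - (D (tgt e))%:R) = 0.
Proof.
move=> /circP[/ffunP m0 _].
transitivity (\sum_(v | D v) (\sum_e m e *: arc_root e) v); last first.
  by rewrite big1 // => v _; rewrite m0 ffunE.
under [RHS]eq_bigr do rewrite sum_ffunE.
rewrite exchange_big /=; apply: eq_bigr => e _.
under eq_bigr do rewrite !ffunE.
rewrite -scaler_sumr sumrB; congr (_ * (_ - _)).
  have [s|s] := boolP (D (src e)); last first.
    by rewrite big1 // => v Dv; case: eqP => // vs; rewrite -vs Dv in s.
  rewrite (bigD1 (src e)) //= eqxx big1 ?addr0 // => v /andP[_ /negPf->] //.
have [s|s] := boolP (D (tgt e)); last first.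
  by rewrite big1 // => v Dv; case: eqP => // vs; rewrite -vs Dv in s.
by rewrite (bigD1 (tgt e)) //= eqxx big1 ?addr0 // => v /andP[_ /negPf->].
Qed.

Lemma flow X u v : reach X u v -> exists f,
  [/\ forall e, 0 <= f e, forall e, e \notin X -> f e = 0
    & \sum_e f e *: arc_root e = basis_vec R u - basis_vec R v].
Proof.
case/connectP=> p; elim: p u => /= [|w p IH] u; first move=> _ ->.
  exists 0; split=> [e|e _|]; rewrite ?ffunE //.
  by rewrite subrr big1 // => e _; rewrite ffunE scale0r.
case/andP=> /adjacentP[e0 e0X [se te]] pth lst.
have [f [f0 fX fs]] := IH w pth lst.
exists [ffun e => (e == e0)%:R + f e]; split=> [e|e nX|].
- by rewrite ffunE addr_ge0 ?ler0n.
- by rewrite ffunE fX // addr0; case: eqP nX => // ->; rewrite e0X.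
under eq_bigr do rewrite ffunE scalerDl.
rewrite big_split /= fs (bigD1 e0) //= eqxx scale1r big1 ?addr0 => [|e /negPf->].
  by rewrite /arc_root /Defs.root se te addrA subrK.
by rewrite scale0r.
Qed.

(* The circulation runs once along [e] and back along a path of [X]. *)
Lemma circ_arc X e : reach X (tgt e) (src e) -> exists2 m, m \in circ (e |: X) &
  (forall g, 0 <= m g) /\ 1 <= m e.
Proof.
case/flow=> f [f0 fX fs]; exists [ffun g => (g == e)%:R + f g].
  apply/circP; split=> [|g].
    under eq_bigr do rewrite ffunE scalerDl.
    rewrite big_split /= fs (bigD1 e) //= eqxx scale1r big1 ?addr0 => [|g /negPf->].
      by rewrite /arc_root /Defs.root addrC subrKA subrr.
    by rewrite scale0r.
  by rewrite !inE ffunE => /norP[/negPf-> /fX->]; rewrite addr0.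
split=> [g|]; rewrite ffunE; first by rewrite addr_ge0 ?ler0n.
by rewrite eqxx lerDl.
Qed.

(** Each arc of [S] lies on a directed cycle; one circulation for each arc, added up, is positive on
    all of [S]. *)
Lemma circ_cyc S : cyc S = S -> exists2 m, m \in circ S &
  (forall e, 0 <= m e) /\ (forall e, e \in S -> 0 < m e).
Proof.
move=> cS.
have H e : exists m, [/\ m \in circ S, forall g, 0 <= m g & e \in S -> 0 < m e].
  have [eS|_] := boolP (e \in S); last first.
    by exists 0; split=> //; [exact: mem0v|move=> g; rewrite ffunE].
  have /circ_arc[m mS [m0 m1]] : reach S (tgt e) (src e).
    by move: eS; rewrite -{1}cS mem_cyc => /andP[].
  exists m; split=> // [|_]; last exact: lt_le_trans m1.
  by move: mS; rewrite (setUidPr _) // sub1set.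
have [F HF] := fin_all_exists H; exists (\sum_e F e).
  by apply: memv_suml => e _; case: (HF e).
have F0 e g : 0 <= F e g by case: (HF e).
split=> [g|e eS]; rewrite sum_ffunE; first by apply: sumr_ge0.
rewrite (bigD1 e) //= ltr_wpDr ?sumr_ge0 //.
by case: (HF e) => _ _; exact.
Qed.

(** If an arc [e] of the support had no return path, the set of vertices reached from [tgt e] would
    be entered by [e] and left by no arc of the support, so its net flow could not vanish. *)
Lemma cyc_supp m : \sum_e m e *: arc_root e = 0 -> (forall e, 0 <= m e) ->
  cyc [set e | m e != 0] = [set e | m e != 0].
Proof.
set S := [set e | _] => ms m0.
have mS : m \in circ S.
  by apply/circP; split=> // e; rewrite inE negbK => /eqP.
apply/eqP; rewrite eqEsubset cyc_sub /=; apply/subsetP => e eS.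
rewrite mem_cyc eS /=; apply: contraT => nre.
have := circ_cut (reach S (tgt e)) mS.
under eq_bigr => g _.
  suff -> : m g * ((reach S (tgt e) (src g))%:R - (reach S (tgt e) (tgt g))%:R) =
     - (m g * (~~ reach S (tgt e) (src g) && reach S (tgt e) (tgt g))%:R).
    over.
  have [gS|] := boolP (g \in S); last first.
    by rewrite inE negbK => /eqP->; rewrite !mul0r oppr0.
  have [r1|r1] := boolP (reach S (tgt e) (src g)).
    by rewrite (reach_trans r1 (reach_arc _ _ gS)) subrr mulr0 oppr0.
  by rewrite sub0r mulrN.
move/eqP; rewrite sumrN oppr_eq0 psumr_eq0 => [|g _]; last by rewrite mulr_ge0 ?ler0n.
move/allP/(_ e (mem_index_enum _)) => /=; rewrite nre reach0 mulr1.
by move: eS; rewrite inE => /negPf->.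
Qed.

Lemma nullity_sub X Y : X \subset Y -> (nullity X <= nullity Y)%N.
Proof. by move=> sXY; apply: dimvS; exact: circ_sub. Qed.

Lemma nullity_setU1_eq X e : (forall m, m \in circ (e |: X) -> m e = 0) ->
  nullity (e |: X) = nullity X.
Proof.
move=> me; congr (\dim _); apply/eqP; rewrite eqEsubv [X in _ && X]circ_sub ?subsetUr // andbT.
apply/subvP => m mX; have [m0 ms] := circP _ _ mX; apply/circP; split=> // g gX.
have [->|ng] := eqVneq g e; first exact: me.
by apply: ms; rewrite !inE negb_or ng.
Qed.

Lemma nullity_setU1_new X e m : e \notin X -> m \in circ (e |: X) -> m e != 0 ->
  nullity (e |: X) = (nullity X).+1.
Proof.
move=> eX mX me; have sX : X \subset e |: X by exact: subsetUr.
have -> : nullity (e |: X) = \dim (circ X + <[m]>)%VS.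
  congr (\dim _); apply/eqP; rewrite eqEsubv; apply/andP; split.
    (* Subtracting [c *: m] clears the coordinate of [w] at [e] and leaves a circulation of [X]. *)
    apply/subvP => w wX; pose c := w e / m e.
    rewrite -(subrK (c *: m) w) memv_add ?memvZ ?memv_line //.
    have /circP[v0 vs] : w - c *: m \in circ (e |: X) by rewrite memvB ?memvZ.
    apply/circP; split=> // g gX; have [->|ng] := eqVneq g e.
      by rewrite !ffunE /c [_ *: _](divfK me) subrr.
    by apply: vs; rewrite !inE negb_or ng.
  by rewrite subv_add circ_sub //= -memvE.
rewrite dimv_disjoint_sum.
  rewrite dim_vline; suff -> : m != 0 by rewrite addn1.
  by apply: contraNneq me => ->; rewrite ffunE.
apply/eqP; rewrite -subv0; apply/subvP => w; rewrite memv_cap => /andP[/circP[_ wX]].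
case/vlineP=> c wc; have := wX e eX; rewrite wc ffunE => /eqP.
by rewrite mulf_eq0 (negPf me) orbF => /eqP->; rewrite scale0r mem0v.
Qed.

Lemma nullity_setU1_le X e : (nullity (e |: X) <= (nullity X).+1)%N.
Proof.
have [eX|eX] := boolP (e \in X); first by rewrite (setUidPr _) ?sub1set.
case: (boolp.pselect (forall m, m \in circ (e |: X) -> m e = 0)) => [/nullity_setU1_eq-> //|].
move/boolp.existsNP => [m] /boolp.not_implyP[mX /eqP me].
by rewrite (nullity_setU1_new eX mX me).
Qed.

Lemma nullity_le X Y : X \subset Y -> (nullity Y <= nullity X + #|Y :\: X|)%N.
Proof.
move: {2}#|_| (erefl #|Y :\: X|) => n; elim: n X => [|n IH] X cn sXY.
  rewrite cn addn0; suff -> : X = Y by [].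
  apply/eqP; rewrite eqEsubset sXY -setD_eq0; exact/eqP/cards0_eq.
have /set0Pn[e] : Y :\: X != set0 by rewrite -card_gt0 cn.
rewrite inE => /andP[eX eY].
have c' : #|Y :\: (e |: X)| = n.
  by apply: succn_inj; rewrite -cn [RHS](cardsD1 e) inE eX eY setUC setDDl.
rewrite cn addnS -addSn; apply: leq_trans (IH _ c' _) _.
  by rewrite subUset sub1set eY.
by rewrite c' leq_add2r nullity_setU1_le.
Qed.

(* No circulation of [e |: X] uses [e], the only arc across the cut [D]. *)
Lemma nullity_setU1_cut X e D : D (src e) != D (tgt e) ->
  (forall g, g \in X -> D (src g) = D (tgt g)) -> nullity (e |: X) = nullity X.
Proof.
move=> De DX; apply: nullity_setU1_eq => m mX.
have := circ_cut D mX; rewrite (bigD1 e) //= big1 ?addr0 => [|g ge].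
  move/eqP; rewrite mulf_eq0 => /orP[/eqP//|].
  by move: De; case: (D _); case: (D _); rewrite ?subr0 ?sub0r ?oppr_eq0 ?oner_eq0.
have [gX|gX] := boolP (g \in X); first by rewrite DX // subrr mulr0.
by case/circP: mX => _ ->; rewrite ?mul0r // !inE negb_or ge.
Qed.

(** The circulation is [e] plus a path from [u] to [src e] minus a path from [u] to [tgt e]. Its
    value at [e] is known only for [e] outside [X], where neither path can use it. *)
Lemma circ_spanning u X e : spanning u X -> exists2 m, m \in circ (e |: X) &
  e \notin X -> m e = 1.
Proof.
move=> /spanningP RX; have [f [_ fX fs]] := flow (RX (src e)).
have [g [_ gX gs]] := flow (RX (tgt e)).
exists [ffun c => (c == e)%:R + f c - g c]; last first.
  by move=> eX; rewrite ffunE eqxx fX // gX // subr0 addr0.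
apply/circP; split=> [|c]; last first.
  by rewrite !inE ffunE => /norP[/negPf-> cX]; rewrite fX // gX // addr0 subrr.
under eq_bigr do rewrite ffunE scalerBl scalerDl.
rewrite sumrB big_split /= fs gs (bigD1 e) //= eqxx scale1r big1 ?addr0 => [|c /negPf->];
  last by rewrite scale0r.
by rewrite /arc_root /Defs.root [X in X - _]addrC subrKA subrr.
Qed.

(** In a graph reached from [u] every further arc closes an undirected cycle, hence adds exactly one
    to the nullity. *)
Lemma nullity_spanning u X Y : spanning u X -> X \subset Y ->
  nullity Y = (nullity X + #|Y :\: X|)%N.
Proof.
move: {2}#|_| (erefl #|Y :\: X|) => n; elim: n X => [|n IH] X cn RX sXY.
  rewrite cn addn0; suff -> : X = Y by [].
  apply/eqP; rewrite eqEsubset sXY -setD_eq0; exact/eqP/cards0_eq.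
have /set0Pn[e] : Y :\: X != set0 by rewrite -card_gt0 cn.
rewrite inE => /andP[eX eY].
have c' : #|Y :\: (e |: X)| = n.
  by apply: succn_inj; rewrite -cn [RHS](cardsD1 e) inE eX eY setUC setDDl.
rewrite (IH _ c') ?(spanning_sub _ RX) ?subsetUr // ?subUset ?sub1set ?eY // c' cn.
have [m mX /(_ eX) me] := circ_spanning e RX.
by rewrite (nullity_setU1_new eX mX) ?addSnnS // me oner_eq0.
Qed.

End Circulations.

(** * The signed sum *)

Lemma sum_involution_eq0 (A : idomainType) (I : finType) (P : pred I) (F : I -> A)
    (h : I -> I) : 2 != 0 :> A -> involutive h -> (forall i, P i -> P (h i)) ->
  (forall i, P i -> F (h i) = - F i) -> \sum_(i | P i) F i = 0.
Proof.
move=> A2 hK Ph Fh; set s := \sum_(i | P i) F i.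
have : s = - s.
  rewrite {1}/s (reindex_inj (inv_inj hK)) /= -sumrN.
  rewrite (eq_bigl P) => [|i]; first exact: eq_bigr.
  by apply/idP/idP => [/Ph|/Ph //]; rewrite hK.
move/eqP; rewrite -addr_eq0 -mulr2n -mulr_natl mulf_eq0 (negPf A2) /=.
by move/eqP.
Qed.

Lemma sum_subsets_expr (A : comNzRingType) (E : finType) (X Y : {set E}) (x : A) :
  X \subset Y ->
  \sum_(Z : {set E} | (X \subset Z) && (Z \subset Y)) x ^+ #|Z :\: X| =
  (x + 1) ^+ #|Y :\: X|.
Proof.
move=> sXY.
(* [F e] is the weight of [e] inside [Z], [G e] its weight outside; the zeros kill every [Z] that
   misses part of [X] or leaves [Y]. *)
pose F e := if e \in X then 1 else if e \in Y then x else 0 : A.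
pose G e := if e \in X then 0 else 1 : A.
have FG e : F e + G e = if e \in Y :\: X then x + 1 else 1.
  rewrite /F /G inE; have [eX|eX] /= := boolP (e \in X); first by rewrite addr0.
  by case: ifP; rewrite ?add0r.
transitivity (\prod_e (F e + G e)); last first.
  rewrite (eq_bigr _ (fun e _ => FG e)) -big_mkcond /= prodr_const; congr (_ ^+ _).
rewrite bigA_distr [RHS](bigID (fun Z : {set E} => (X \subset Z) && (Z \subset Y))) /=.
rewrite [X in _ = _ + X]big1 ?addr0 => [|Z]; last first.
  rewrite negb_and => /orP[/subsetPn[e eX eZ]|/subsetPn[e eZ eY]].
    by rewrite (bigD1 e) //= (negPf eZ) /G eX mul0r.
  rewrite (bigD1 e) //= eZ /F (negPf eY); case: ifP => [eX|]; last by rewrite mul0r.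
  by rewrite (subsetP sXY) in eY.
apply: eq_bigr => Z /andP[sXZ sZY].
rewrite -prodr_const big_mkcond /=; apply: eq_bigr => e _.
rewrite inE /F /G; have [eX|eX] /= := boolP (e \in X).
  by rewrite (subsetP sXZ).
by have [eZ|eZ] := boolP (e \in Z); rewrite // (subsetP sZY).
Qed.

Section SignedSum.
Variables (R : realType) (V E : finType) (src tgt : E -> V) (u : V).
Implicit Types (X Y S Z : {set E}) (v w : V) (C : {set V}).

Local Notation reach := (reach src tgt).
Local Notation cyc := (cyc src tgt).
Local Notation spanning := (spanning src tgt).
Local Notation nullity := (nullity R src tgt).

Definition into C : {set E} := [set g | tgt g \in C].

Section FixedEnds.
Variables S Z : {set E}.
Hypotheses (cS : cyc S = S) (RZ : spanning u Z).

(* [explored C Y]: [Y] is [S] together with a tree of arcs reaching from [u] the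
   part [C] explored so far; an extension of it has the same arcs entering [C].
   Toggling an arc [e] leaving [C] pairs off all extensions but those in which
   [e] is the only arc outside [S] entering the component of [tgt e]. *)
Definition extension C Y X :=
  [&& S \subset X, X \subset Z, cyc X == S, spanning u X &
      X :&: into C == Y :&: into C].

Definition explored C Y :=
  [/\ [/\ S \subset Y, Y \subset Z, cyc Y = S & nullity Y = nullity S],
      u \in C, forall v, v \in C -> reach Y u v,
      forall g, g \in Y -> (src g \in C) = (tgt g \in C)
    & forall g, g \in Y -> tgt g \notin C -> g \in S].

Section Step.
Variables (C : {set V}) (Y : {set E}) (e : E).
Hypotheses (expl : explored C Y) (eZ : e \in Z).
Hypotheses (se : src e \in C) (te : tgt e \notin C).

Let C' := C :|: [set v | reach S (tgt e) v].
Let Y' := e |: Y.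

Lemma explored_notin : e \notin Y.
Proof.
case: expl => _ _ _ cut _; apply: contraNN te => eY; by rewrite -(cut e).
Qed.

(** No arc of [Y] crosses the boundary of [C], so [e] creates neither a directed cycle nor a
    circulation. The whole component of [tgt e] in [S] joins [C], so that again no arc crosses the
    boundary. *)
Lemma explored_step : explored C' Y'.
Proof.
have [[sSY sYZ cY nY] uC reC cut YS] := expl.
have ne : ~~ reach Y (tgt e) (src e).
  apply/negP => r; have := reach_closed (D := fun v => v \notin C) _ r te.
  by rewrite se => H; suff: false by []; apply: H => g gY; rewrite cut.
have sYY : Y \subset Y' by exact: subsetUr.
have re : reach Y' u (tgt e).
  by apply: reach_trans (reach_sub sYY (reC _ se)) (reach_arc _ _ (setU11 _ _)).
split.
- split; first exact: subset_trans sYY.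
  + by rewrite subUset sub1set eZ.
  + by rewrite cyc_setU1.
  + rewrite -nY; apply: (@nullity_setU1_cut _ _ _ _ _ _ _ (fun v => v \in C)).
      by rewrite se (negPf te).
    exact: cut.
- by rewrite inE uC.
- move=> v; rewrite !inE => /orP[/reC|rv]; first exact: reach_sub.
  by apply: reach_trans re _; apply: reach_sub rv; apply: subset_trans sYY.
- move=> g; rewrite !inE => /orP[/eqP->|gY]; first by rewrite se reach0 orbT.
  rewrite cut //; have [//|tC /=] := boolP (tgt g \in C).
  have gS := YS _ gY tC; apply/idP/idP => r; apply: (reach_trans r).
    exact: reach_arc.
  by apply: cyc_reach_sym => //; exact: reach_arc.
- move=> g; rewrite !inE => /orP[/eqP->|gY]; first by rewrite reach0 orbT.
  by move/norP=> [tC _]; exact: YS.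
Qed.

(** The arcs of [X] with target in [C] are arcs of [Y], and none of those crosses the boundary of
    [C]. *)
Lemma extension_closed X g : extension C Y X -> g \in X ->
  tgt g \in C -> src g \in C.
Proof.
have [_ _ _ cut _] := expl.
move=> /and5P[_ _ _ _ /eqP/setP/(_ g)]; rewrite !inE => H gX tg.
by rewrite cut //; move: H; rewrite gX tg !andbT => <-.
Qed.

Lemma extension_noreturn X : extension C Y X -> ~~ reach X (tgt e) (src e).
Proof.
move=> eX; apply/negP => r; have := reach_closed (D := fun v => v \notin C) _ r te.
rewrite se => H; suff: false by []; apply: H => g gX; apply: contraNN.
exact: extension_closed eX gX.
Qed.

Lemma into_step : Y' :&: into C' = e |: (Y :&: into C').
Proof.
by apply/setP => g; rewrite !inE; case: eqP => //= ->; rewrite reach0 orbT.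
Qed.

Lemma extension_step X : extension C' Y' X -> extension C Y X.
Proof.
case/and5P=> h1 h2 h3 h4 /eqP/setP h5; apply/and5P; split=> //.
apply/eqP/setP => g; have := h5 g; rewrite !inE.
have [tg /=|] := boolP (tgt g \in C); last by rewrite !andbF.
by rewrite !andbT => ->; case: eqP => [ge|//]; move: te; rewrite -ge tg.
Qed.

Definition toggle X := if e \in X then X :\ e else e |: X.

Lemma toggleK : involutive toggle.
Proof.
move=> X; rewrite /toggle; have [eX|eX] := boolP (e \in X).
  by rewrite setD11 setD1K.
by rewrite setU11 setU1K.
Qed.

(** These extensions are lost in passing to the next stage; [toggle] acts on them and cancels their
    terms. *)
Let unpaired X := extension C Y X && ~~ extension C' Y' X.

Lemma unpaired_into X : unpaired X -> extension C Y X /\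
  X :&: into C' != Y' :&: into C'.
Proof.
rewrite /unpaired => /andP[eX nX]; split=> //; move: nX; have /and5P[h1 h2 h3 h4 _] := eX.
by rewrite {1}/extension h1 h2 h3 h4.
Qed.

(** Were [e |: X] an extension of the next stage, [e] would be its only arc outside [S] entering the
    component of [tgt e]; then [X], which lacks [e], could not reach that component. *)
Lemma unpaired_add X : e \notin X -> unpaired X -> unpaired (e |: X).
Proof.
move=> neX /unpaired_into[eX _]; have /and5P[sSX sXZ /eqP cX RX iX] := eX.
have [[sSY sYZ cY nY] uC reC cut YS] := expl.
have eeX : extension C Y (e |: X).
  apply/and5P; split.
  - by apply: subset_trans sSX _; exact: subsetUr.
  - by rewrite subUset sub1set eZ.
  - by rewrite cyc_setU1 ?cX //; exact: extension_noreturn.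
  - by apply: spanning_sub RX; exact: subsetUr.
  - apply/eqP/setP => g; rewrite -(eqP iX) !inE; case: eqP => //= ->.
    by rewrite (negPf te) !andbF.
rewrite /unpaired eeX /=; apply/negP => /and5P[_ _ _ _ /eqP/setP h].
have XY g : g \in X -> tgt g \in C' -> g \in Y.
  move=> gX tg; have := h g; rewrite in_setI [g \in into _]inE tg andbT.
  rewrite in_setU1 gX orbT => /esym/setIP[]; rewrite in_setU1 => /orP[/eqP ge|//].
  by rewrite ge (negPf neX) in gX.
have /spanningP/(_ (tgt e)) r := RX.
pose D v := ~~ reach S (tgt e) v.
have nu : forall v, v \in C -> D v.
  move=> v vC; apply/negP => rv.
  have := reach_closed (D := fun v => v \notin C) _ rv te.
  rewrite vC => H; suff: false by []; apply: H => g gS.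
  by rewrite cut //; apply: (subsetP sSY).
have : D (tgt e).
  apply: (reach_closed _ r (nu _ uC)) => g gX; apply: contraNN => tg.
  have gY : g \in Y by apply: XY => //; rewrite !inE tg orbT.
  have gS : g \in S.
    by apply: YS => //; apply/negP => /nu; rewrite /D tg.
  by apply: (reach_trans tg); apply: cyc_reach_sym => //; exact: reach_arc.
by rewrite /D reach0.
Qed.

(* [X] has another arc [f] entering the component of [tgt e]; its source is
   reached without [e], as otherwise [f] would lie on a directed cycle. *)
Lemma unpaired_remove X : e \in X -> unpaired X -> unpaired (X :\ e).
Proof.
move=> heX /unpaired_into[eX iX']; have /and5P[sSX sXZ /eqP cX RX iX] := eX.
have [[sSY sYZ cY nY] uC reC cut YS] := expl.
have neY := explored_notin.
have neS : e \notin S by apply: contraNN neY => /(subsetP sSY).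
have sX : X :\ e \subset X by exact: subD1set.
have sS : S \subset X :\ e by rewrite subsetD1 sSX.
have rX g : g \in X -> tgt g \in C = false -> g \notin S -> g != e ->
    reach S (tgt e) (tgt g) -> reach (X :\ e) u (tgt e).
  move=> gX tg gS ge rg; have /spanningP/(_ (src g)) r := RX.
  have rg' : reach S (tgt g) (tgt e) by exact: cyc_reach_sym.
  case/orP: (reach_setD1 e r) => [r1|/andP[_ r1]].
    apply: reach_trans r1 _; apply: reach_trans (reach_sub sS rg').
    by apply: reach_arc; rewrite !inE ge.
  case/negP: gS; rewrite -cX mem_cyc gX /=.
  by apply: reach_trans (reach_sub sSX rg') _; exact: reach_sub r1.
have R' : spanning u (X :\ e).
  suff rw : reach (X :\ e) u (tgt e).
    apply/spanningP => v; have /spanningP/(_ v) r := RX.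
    case/orP: (reach_setD1 e r) => [//|/andP[_]]; exact: reach_trans.
  (* [X] contains all arcs of [Y'] entering [C'], so the two sets can differ only by an arc [g] of
     [X] beyond [Y'], which supplies the second entrance. *)
  move: iX'; rewrite eqEsubset negb_and into_step => /orP[]/subsetPn[g].
    move=> /setIP[gX tg]; rewrite in_setU1 => /norP[ge]; rewrite in_setI tg andbT => gY.
    have tC : tgt g \in C = false.
      apply/negP => tC; have /setP/(_ g) := eqP iX.
      by rewrite !inE tC gX (negPf gY).
    apply: (rX _ gX tC _ ge).
      by apply: contraNN gY => /(subsetP sSY).
    by move: tg; rewrite !inE tC.
  rewrite in_setU1 => /orP[/eqP->|/setIP[gY tg]].
    by rewrite in_setI heX !inE reach0 orbT.
  rewrite in_setI tg andbT => gX; case/negP: (gX).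
  have [tC|tC] := boolP (tgt g \in C).
    by have /setP/(_ g) := eqP iX; rewrite !inE tC gY andbT => ->.
  by apply: (subsetP sSX); exact: YS.
have eeX : extension C Y (X :\ e).
  apply/and5P; split=> //.
  - exact: subset_trans sXZ.
  - have := extension_noreturn eX => ne.
    apply/eqP; rewrite -cX -[in RHS](setD1K heX) cyc_setU1 //.
    by apply: contraNN ne; exact: reach_sub.
  - apply/eqP/setP => g; rewrite -(eqP iX) !inE; case: eqP => //= ->.
    by rewrite (negPf te) !andbF.
rewrite /unpaired eeX /=; apply/negP => /and5P[_ _ _ _ /eqP/setP/(_ e)].
by rewrite into_step in_setI setD11 setU11.
Qed.

(** The graphs are spanning, so adding [e] raises the nullity by one and [toggle] reverses signs. *)
Lemma sum_extension_step :
  \sum_(X | extension C Y X) (-1) ^+ (nullity X - nullity S) =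
  \sum_(X | extension C' Y' X) (-1) ^+ (nullity X - nullity S) :> int.
Proof.
rewrite (bigID (extension C' Y')) /= [X in _ + X](sum_involution_eq0 _ toggleK) //.
- rewrite addr0; apply: eq_bigl => X; rewrite andbC.
  by case: (boolP (extension C' Y' X)) => //= /extension_step.
- move=> X; rewrite /toggle; case: ifPn; [exact: unpaired_remove|exact: unpaired_add].
have H X : e \notin X -> unpaired X ->
    (-1) ^+ (nullity (e |: X) - nullity S) = - (-1) ^+ (nullity X - nullity S) :> int.
  rewrite /unpaired => heX /andP[/and5P[sSX _ _ RX _] _].
  rewrite (nullity_spanning _ RX (subsetUr [set e] X)) setDUl setDv setU0.
  have -> : [set e] :\: X = [set e].
    by apply/setP => g; rewrite !inE andbC; case: eqP => // ->.
  by rewrite cards1 addn1 subSn ?nullity_sub // exprS mulN1r.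
move=> X uX; rewrite /toggle; case: ifPn => heX; last exact: H.
by rewrite -{2}(setD1K heX) H ?setD11 ?opprK //; exact: unpaired_remove.
Qed.

End Step.

Lemma sum_extension_full Y : explored [set: V] Y ->
  \sum_(X | extension [set: V] Y X) (-1) ^+ (nullity X - nullity S) = 1 :> int.
Proof.
move=> [[sSY sYZ cY nY] _ reC _ _].
rewrite (eq_bigl (pred1 Y)) ?big_pred1_eq ?nY ?subnn // => X.
have iT : into [set: V] = [set: E] by apply/setP => g; rewrite !inE.
rewrite /extension iT !setIT /=; apply/and5P/eqP => [[_ _ _ _ /eqP//]|->].
by split=> //; [exact/eqP|apply/spanningP => v; apply: reC; rewrite inE].
Qed.

Lemma sum_extension C Y : explored C Y ->
  \sum_(X | extension C Y X) (-1) ^+ (nullity X - nullity S) = 1 :> int.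
Proof.
move: {2}#|_| (leqnn #|~: C|) => n; elim: n C Y => [|n IH] C Y cn expl.
  move: cn expl; rewrite leqn0 cards_eq0 => /eqP cC; rewrite -(setCK C) cC setC0.
  exact: sum_extension_full.
have [CT|nC] := eqVneq C [set: V].
  by rewrite CT; apply: sum_extension_full; rewrite -CT.
have uC : u \in C by case: expl.
have [|e eZ /andP[se te]] := spanning_exit (D := fun v => v \in C) RZ uC.
  apply: contraNN nC => /forallP H; apply/eqP/setP => v; by rewrite H inE.
rewrite (sum_extension_step expl eZ se te); apply: IH; last exact: explored_step.
rewrite -ltnS; apply: leq_trans cn; apply: proper_card; apply/properP; split.
  by rewrite setCS subsetUl.
by exists (tgt e); rewrite !inE ?te // reach0 orbT.
Qed.

End FixedEnds.

(** The exploration starts with the vertices reached within [S]. An arc of [X] entering this part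
    has a return path through [u], so it lies in [cyc X = S], and the condition on entering arcs
    holds automatically. *)
Lemma signed_sum S Z : cyc S = S -> S \subset Z -> spanning u Z ->
  \sum_(X : {set E} | [&& S \subset X, X \subset Z, cyc X == S & spanning u X])
    (-1) ^+ (nullity X - nullity S) = 1 :> int.
Proof.
move=> cS sSZ RZ.
pose C := [set v | reach S u v].
have expl : explored S Z C S.
  split=> //; [by rewrite inE reach0|by move=> v; rewrite inE|move=> g gS].
  rewrite !inE; apply/idP/idP => r; apply: (reach_trans r); first exact: reach_arc.
  by apply: cyc_reach_sym => //; exact: reach_arc.
rewrite -[RHS](sum_extension cS RZ expl); apply: eq_bigl => X; rewrite /extension.
apply/and4P/and5P => [[sSX sXZ /eqP cX RX]|[]//]; split=> //; first exact/eqP.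
apply/eqP/setP => g; rewrite !inE; have [r|] := boolP (reach S u (tgt g)); last by rewrite !andbF.
rewrite !andbT; apply/idP/idP; last exact: (subsetP sSX).
move=> gX; rewrite -cX mem_cyc gX /=; have /spanningP/(_ (src g)) := RX.
by apply: reach_trans; apply: (reach_sub sSX); exact: cyc_reach_sym.
Qed.

End SignedSum.

(** * The polynomials G_S *)

Lemma coef_g_of_h D (h : {poly int}) i : (g_of_h D h)`_i =
  if (i <= D./2)%N then (if i is j.+1 then h`_i - h`_j else h`_0) else 0.
Proof.
have -> : g_of_h D h =
    \poly_(i < (D./2).+1) (if i is j.+1 then h`_i - h`_j else h`_0).
  rewrite poly_def big_ord_recl /= alg_polyC /g_of_h; congr (_ + _).
  by rewrite -(big_mkord xpredT (fun i => (h`_i.+1 - h`_i) *: 'X^(i.+1))) big_add1.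
by rewrite coef_poly.
Qed.

(* With [G] in low degrees and [Q] in high ones, [Q = G + (t - 1) h] determines
   [G] as the truncation of [(1 - t) h]. *)
Lemma g_of_h_unique D (h G Q : {poly int}) : ('X - 1) * h + G = Q ->
  (forall i, (i <= D./2)%N -> Q`_i = 0) -> (size G <= (D./2).+1)%N ->
  g_of_h D h = G.
Proof.
move=> eQ Q0 sG; apply/polyP => i; rewrite coef_g_of_h; case: leqP => [le|lt].
  have := Q0 i le; rewrite -eQ coefD mulrBl mul1r coefB coefXM.
  by case: i {le} => [|i] /= /addr0_eq <-; rewrite ?sub0r ?opprK ?opprB.
by rewrite nth_default // (leq_trans sG).
Qed.

Section RootedPoly.
Variables (R : realType) (V E : finType) (src tgt : E -> V) (u : V).
Implicit Types (X Y S Z : {set E}).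

Local Notation reach := (reach src tgt).
Local Notation cyc := (cyc src tgt).
Local Notation spanning := (spanning src tgt).
Local Notation nullity := (nullity R src tgt).

(** This is [G_S]; the subtraction in the exponent is exact, as [S = cyc X] lies in [X]. *)
Definition rooted_poly S : {poly int} :=
  \sum_(X : {set E} | spanning u X && (cyc X == S)) ('X - 1) ^+ (nullity X - nullity S).

Lemma sum_rooted_poly S : cyc S = S ->
  \sum_(S' : {set E} | (cyc S' == S') && (S \subset S'))
     rooted_poly S' * ('X - 1) ^+ (nullity S' - nullity S) =
  \sum_(X : {set E} | spanning u X && (S \subset X))
     ('X - 1) ^+ (nullity X - nullity S).
Proof.
move=> cS.
rewrite [RHS](partition_big cyc (fun S' => (cyc S' == S') && (S \subset S'))) /=.
  apply: eq_bigr => S' /andP[/eqP cS' sSS'].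
  rewrite mulr_suml; apply: eq_big => [X|X /andP[RX /eqP cX]].
    case: (spanning u X) => //=; apply/eqP/andP => [cX|[_ /eqP//]].
    by rewrite cX eqxx (subset_trans sSS') // -cX cyc_sub.
  by rewrite -exprD addnC addnBAC ?subnKC ?nullity_sub // -cX cyc_sub.
move=> X /andP[_ sSX]; rewrite cyc_id eqxx -cS; exact: cyc_mono.
Qed.

(** A circulation positive on all of [S'] is nonzero at an arc outside [S], so it is lost when that
    arc is removed. *)
Lemma nullity_cyc_lt S S' : cyc S' = S' -> S \proper S' -> (nullity S < nullity S')%N.
Proof.
move=> cS' /properP[sSS' [e eS' eS]].
have [m mS' [_ /(_ e eS') m0]] := circ_cyc R cS'.
have m1 : m \in circ R src tgt (e |: (S' :\ e)) by rewrite setD1K.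
rewrite -(setD1K eS') (nullity_setU1_new _ m1) ?setD11 ?gt_eqF // ltnS.
by apply: nullity_sub; rewrite subsetD1 sSS'.
Qed.

(** Each [Z] is multiplied by its signed sum, which is 1; after exchanging sums, the [Z] containing
    a fixed [X] give ['X^#|~: X|] by the binomial theorem. As [z(E) - z(S)] equals
    [z(X) - z(S) + #|~: X|], the right side is the reciprocal of [G_S], namely
    [t^(z(E) - z(S)) G_S(1/t)]. *)
Lemma sum_spanning_recip S : cyc S = S ->
  \sum_(Z : {set E} | spanning u Z && (S \subset Z))
     ('X - 1) ^+ (nullity Z - nullity S) =
  \sum_(X : {set E} | spanning u X && (cyc X == S))
     (1 - 'X) ^+ (nullity X - nullity S) * 'X^#|~: X| :> {poly int}.
Proof.
move=> cS; set q : {poly int} := 'X - 1.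
pose F X Z : {poly int} := (-1) ^+ (nullity X - nullity S) * q ^+ (nullity Z - nullity S).
transitivity (\sum_(Z : {set E} | spanning u Z && (S \subset Z))
   \sum_(X : {set E} | [&& S \subset X, X \subset Z, cyc X == S & spanning u X]) F X Z).
  apply: eq_bigr => Z /andP[RZ sSZ].
  have /(congr1 (fun x : int => x%:P)) := signed_sum R cS sSZ RZ.
  rewrite rmorph_sum rmorph1 /= => H; rewrite -mulr_suml -[LHS]mul1r.
  by congr (_ * _); rewrite -[LHS]H; apply: eq_bigr => X _; rewrite rmorphXn rmorphN1.
rewrite (exchange_big_dep (fun X => spanning u X && (cyc X == S))) /=; last first.
  by move=> Z X _ /and4P[_ _ -> ->].
apply: eq_bigr => X /andP[RX /eqP cX].
have sSX : S \subset X by rewrite -cX; exact: cyc_sub.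
transitivity (\sum_(Z : {set E} | (X \subset Z) && (Z \subset [set: E]))
    (1 - 'X) ^+ (nullity X - nullity S) * q ^+ #|Z :\: X|).
  apply: eq_big => [Z|Z /andP[_ /and4P[_ sXZ _ _]]].
    rewrite subsetT sSX cX eqxx RX /= !andbT; case: (boolP (X \subset Z)) => [sXZ|];
      rewrite ?andbF //.
    by rewrite (spanning_sub sXZ RX) (subset_trans sSX sXZ).
  rewrite /F (nullity_spanning _ RX sXZ) -addnBAC ?nullity_sub // exprD mulrA.
  by rewrite -exprMn mulN1r opprB.
by rewrite -mulr_sumr sum_subsets_expr ?subsetT // setTD subrK.
Qed.

Section Bidirected.
Variable rev : E -> E.
Hypotheses (rev_inj : injective rev) (src_rev : forall e, src (rev e) = tgt e)
  (tgt_rev : forall e, tgt (rev e) = src e).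

(* The reversal of [X :\: S] is disjoint from [X], as [X] would otherwise contain
   a directed 2-cycle outside [cyc X]. *)
Lemma nullity_card_lt S X : cyc S = S -> S != [set: E] -> spanning u X ->
  cyc X = S -> (nullity X - nullity S < #|~: X|)%N.
Proof.
move=> cS nS RX cX; have sSX : S \subset X by rewrite -cX cyc_sub.
have [XS|nXS] := eqVneq X S.
  rewrite XS subnn card_gt0 -setCT (inj_eq (@setC_inj _)).
  exact: nS.
have /subsetPn[e eX eS] : ~~ (X \subset S).
  by apply: contraNN nXS => sXS; rewrite eqEsubset sXS.
have rv : (#|X :\: S| <= #|~: X|)%N.
  rewrite -(card_imset _ rev_inj); apply: subset_leq_card.
  apply/subsetP => x /imsetP[g /setDP[gX gS] ->].
  rewrite inE; apply: contraNN gS => rgX; rewrite -cX mem_cyc gX /=.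
  by rewrite -src_rev -(tgt_rev g) reach_arc.
have eXS : e \in X :\: S by rewrite inE eS.
(* The arc [e] of [X] outside [S] lies on no circulation of [e |: S]; this saves one in the count
   and makes the inequality strict. *)
have ez : nullity (e |: S) = nullity S.
  apply: (@nullity_setU1_cut _ _ _ _ _ _ _ (reach S (tgt e))).
    rewrite reach0 eqb_id; apply: contraNN eS => r; rewrite -cX mem_cyc eX /=.
    exact: reach_sub r.
  move=> g gS; apply/idP/idP => r; apply: (reach_trans r); first exact: reach_arc.
  by apply: cyc_reach_sym => //; exact: reach_arc.
have sX : e |: S \subset X by rewrite subUset sub1set eX.
have := nullity_le R src tgt sX; rewrite ez.
move: rv; rewrite (cardsD1 e) eXS setDDl setUC; lia.
Qed.

Lemma g_of_h_rooted_poly S : cyc S = S -> S != [set: E] ->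
  g_of_h (nullity [set: E] - nullity S - 1)
    (\sum_(S' : {set E} | (cyc S' == S') && (S \proper S'))
       rooted_poly S' * ('X - 1) ^+ (nullity S' - nullity S - 1)) = rooted_poly S.
Proof.
move=> cS nS; set D := (_ - _ - 1)%N.
(* With [a = z(X) - z(S)] and [b = #|~: X|], the relations [a < b] and [D = a + b - 1] give
   [a <= D./2 < b]. *)
have bounds X : spanning u X -> cyc X = S ->
    (nullity X - nullity S <= D./2)%N /\ (D./2 < #|~: X|)%N.
  move=> RX cX; have lt := nullity_card_lt cS nS RX cX.
  have zE := nullity_spanning R RX (subsetT X); rewrite setTD in zE.
  have le : (nullity S <= nullity X)%N by apply: nullity_sub; rewrite -cX cyc_sub.
  rewrite /D zE; lia.
apply: (g_of_h_unique (Q := \sum_(X : {set E} | spanning u X && (cyc X == S))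
     (1 - 'X) ^+ (nullity X - nullity S) * 'X^#|~: X|)).
- rewrite -sum_spanning_recip // -sum_rooted_poly //.
  (* The term at [S' = S] is [G_S]; in the others the exponent is one more than in [h], which is the
     factor [t - 1]. *)
  rewrite [RHS](bigD1 S) /=; last by rewrite cS eqxx subxx.
  rewrite subnn expr0 mulr1 addrC; congr (_ + _); rewrite mulr_sumr.
  apply: eq_big => [S'|S' /andP[/eqP cS' pS]].
    by rewrite properEneq -andbA; congr (_ && _); rewrite andbC eq_sym.
  have lt := nullity_cyc_lt cS' pS.
  rewrite mulrCA -exprS; congr (_ * _ ^+ _); lia.
- move=> i le; rewrite coef_sum big1 // => X /andP[RX /eqP cX].
  by rewrite coefMXn (leq_ltn_trans le) //; case: (bounds X RX cX).
- apply: (leq_trans (size_sum _ _ _)); apply/bigmax_leqP => X /andP[RX /eqP cX].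
  by rewrite -polyC1 size_exp_XsubC ltnS; case: (bounds X RX cX).
Qed.

End Bidirected.

End RootedPoly.

(** * Duality *)

Lemma linear_lfun (K : fieldType) (aT rT : vectType K) (f : aT -> rT) :
  linear f -> exists F : 'Hom(aT, rT), forall x, F x = f x.
Proof.
move=> fL; pose g := HB.pack f (GRing.isLinear.Build _ _ _ _ f fL) : {linear _ -> _}.
by exists (linfun g) => x; rewrite lfunE.
Qed.

Section Duality.
Variables (K : fieldType) (U : vectType K).

(** The coordinates of [m] in a basis are the values of [l] at the coordinate functionals. *)
Lemma bidual (l : 'Hom('Hom(U, K^o), K^o)) :
  exists m : U, forall x : 'Hom(U, K^o), l x = x m.
Proof.
pose e := vbasis (fullv : {vspace U}).
have cP i : exists F : 'Hom(U, K^o), forall x, F x = coord e i x.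
  by apply: linear_lfun => c x y; rewrite linearP.
have [F HF] := fin_all_exists cP.
exists (\sum_(i < \dim (fullv : {vspace U})) l (F i) *: e`_i) => x.
have {1}-> : x = \sum_(i < \dim (fullv : {vspace U})) x e`_i *: F i.
  apply/lfunP => m; rewrite {1}(coord_vbasis (memvf m)) linear_sum sum_lfunE /=.
  by apply: eq_bigr => i _; rewrite linearZ /= scale_lfunE HF [LHS]mulrC.
rewrite !linear_sum; apply: eq_bigr => i _.
by rewrite !linearZ /= [LHS]mulrC.
Qed.

Lemma separation (W : {vspace U}) x : x \notin W ->
  exists2 l : 'Hom(U, K^o), (W <= lker l)%VS & l x != 0.
Proof.
move=> xW; pose e := vbasis (fullv : {vspace U}).
pose y := x - projv W x.
have y0 : y != 0.
  by apply: contraNneq xW => /eqP; rewrite subr_eq0 => /eqP->; exact: memv_proj.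
have [i yi] : exists i, coord e i y != 0.
  apply/existsP; apply: contraNT y0; rewrite negb_exists => /forallP H.
  rewrite (coord_vbasis (memvf y)) big1 // => i _.
  by have := H i; rewrite negbK => /eqP->; rewrite scale0r.
have [l lE] : exists l : 'Hom(U, K^o), forall x, l x = coord e i (x - projv W x).
  by apply: linear_lfun => c a b; rewrite -linearP /= linearP opprD addrACA -scalerBr.
exists l; last by rewrite lE.
by apply/subvP => w wW; rewrite memv_ker lE projv_id // subrr linear0.
Qed.

Variable L : {vspace U}.

Definition restriction (M : {vspace U}) (x : 'Hom(subvs_of L, K^o)) :
    'Hom(subvs_of M, K^o) :=
  (x \o linfun (vsproj L \o (@vsval _ _ M)))%VF.

Lemma restriction_is_linear M : linear (restriction M).
Proof. by move=> c x y; rewrite /restriction comp_lfunDl comp_lfunZl. Qed.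

HB.instance Definition _ (M : {vspace U}) :=
  GRing.isLinear.Build _ _ _ _ (restriction M) (@restriction_is_linear M).

Definition annihilator (M : {vspace U}) : {vspace 'Hom(subvs_of L, K^o)} :=
  lker (linfun (restriction M)).

Lemma annihilatorP (M : {vspace U}) (x : 'Hom(subvs_of L, K^o)) :
  reflect (forall m, m \in M -> x (vsproj L m) = 0) (x \in annihilator M).
Proof.
rewrite memv_ker lfunE /=; apply: (iffP eqP) => [/lfunP H m mM|H].
  by have := H (vsproj M m); rewrite comp_lfunE lfunE /= vsprojK // zero_lfunE.
apply/lfunP => m; rewrite comp_lfunE lfunE /= zero_lfunE; apply: H; exact: subvsP.
Qed.

(** Rank-nullity for the restriction map, which is onto because a functional on [M] extends to [L]
    by projection. *)
Lemma dim_annihilator (M : {vspace U}) : (M <= L)%VS ->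
  (\dim (annihilator M) + \dim M = \dim L)%N.
Proof.
move=> sML.
set f := linfun (restriction M).
have := limg_ker_dim f fullv; rewrite capfv -/(annihilator M) dimvf /=.
have dimH (W : {vspace U}) : dim 'Hom(subvs_of W, K^o) = \dim W by exact: muln1.
rewrite dimH => <-; congr (_ + _)%N.
suff -> : limg f = fullv by rewrite dimvf dimH.
apply/eqP; rewrite eqEsubv subvf; apply/subvP => y _.
apply/memv_imgP; exists (y \o linfun (vsproj M \o (@vsval _ _ L)))%VF; first exact: memvf.
rewrite lfunE /=; apply/lfunP => m; rewrite !comp_lfunE !lfunE /=.
by rewrite vsprojK ?vsvalK // (subvP sML) // subvsP.
Qed.

End Duality.

(** * Faces of the Gale dual polytope *)

Section Faces.
Variables (R : realType) (V E : finType) (src tgt : E -> V).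
Implicit Types (S X : {set E}) (m n : {ffun E -> R^o}).

Local Notation reach := (reach src tgt).
Local Notation cyc := (cyc src tgt).
Local Notation circ := (circ R src tgt).
Local Notation nullity := (nullity R src tgt).
Local Notation rts := (arc_root R src tgt).
Local Notation L := (relations rts).
Local Notation T := (relations_dual rts).
Local Notation beta := (coord_functional rts).

(** Evaluation of [x] at [m]; projecting to [L] first lets [m] range over all vectors instead of the
    subspace type. *)
Definition pairing (x : T) m : R^o := (x : 'Hom(subvs_of L, R^o)) (vsproj L m).

Lemma pairing_sum (w : E -> R) m : m \in L ->
  pairing (\sum_i w i *: beta i) m = \sum_i w i * m i.
Proof.
move=> mL; rewrite /pairing sum_lfunE; apply: eq_bigr => i _.
by rewrite scale_lfunE; congr (_ * _); rewrite coord_functionalE vsprojK.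
Qed.

Lemma pairing_coord e m : m \in L -> pairing (beta e) m = m e.
Proof. by move=> mL; rewrite /pairing coord_functionalE vsprojK. Qed.

Lemma pairingB x y m : pairing (x - y) m = pairing x m - pairing y m.
Proof. by rewrite /pairing add_lfunE opp_lfunE. Qed.

Lemma pairingDr x m n : pairing x (m + n) = pairing x m + pairing x n.
Proof. by rewrite /pairing !linearD. Qed.

Lemma pairingNr x m : pairing x (- m) = - pairing x m.
Proof. by rewrite /pairing !linearN. Qed.

Lemma pairingZr x k m : pairing x (k *: m) = k * pairing x m.
Proof. by rewrite /pairing !linearZ. Qed.

Lemma pairing_lfun m : exists l : 'Hom(T, R^o), forall x, l x = pairing x m.
Proof. by apply: linear_lfun => c x y; rewrite /pairing add_lfunE scale_lfunE. Qed.

Lemma pairing_surj (l : 'Hom(T, R^o)) :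
  exists2 m, m \in L & forall x, l x = pairing x m.
Proof.
have [m lm] := @bidual _ _ l; exists (vsval m); first exact: subvsP.
by move=> x; rewrite /pairing vsvalK.
Qed.

(** This is [F_S]; weights on all arcs that vanish on [S] avoid a hull over a subtype. *)
Definition gale_face S : classical_sets.set T := fun x =>
  exists w : E -> R, [/\ forall i, 0 <= w i, \sum_i w i = 1,
    forall i, i \in S -> w i = 0 & x = \sum_i w i *: beta i].

Lemma gale_face0 : gale_face set0 = gale_dual rts.
Proof.
apply: classical_sets.eq_set => x; apply: boolp.propext.
split=> -[w]; first by case=> w0 w1 _ xw; exists w.
by case=> w0 w1 xw; exists w; split=> // i; rewrite inE.
Qed.

Lemma gale_face_coord S e : e \notin S -> gale_face S (beta e).
Proof.
move=> eS; exists (fun i => (i == e)%:R); split=> [i||i iS|].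
- exact: ler0n.
- by rewrite (bigD1 e) //= eqxx big1 ?addr0 // => i /negPf->.
- by case: eqP iS eS => // -> ->.
by rewrite (bigD1 e) //= eqxx scale1r big1 ?addr0 // => i /negPf->; rewrite scale0r.
Qed.

Lemma gale_face_setT : gale_face [set: E] = classical_sets.set0.
Proof.
apply: classical_sets.eq_set => x; apply: boolp.propext; split=> // -[w [_ w1 w0 _]].
by move: w1; rewrite big1 => [/esym/eqP|i _]; [rewrite oner_eq0|exact: w0].
Qed.

Lemma gale_face_neq0 S : S != [set: E] -> gale_face S <> classical_sets.set0.
Proof.
rewrite -subTset => /subsetPn[e _ eS] F0.
by have := gale_face_coord eS; rewrite F0.
Qed.

Lemma gale_face_sub S S' : S \subset S' -> classical_sets.subset (gale_face S') (gale_face S).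
Proof.
move=> sSS x [w [w0 w1 wS xw]]; exists w; split=> // i iS.
by apply: wS; apply: (subsetP sSS).
Qed.

(* [gale_face S'] is cut out of [gale_face S] by a circulation of support [S'],
   nonnegative outside [S]. *)
Lemma pairing_eq0 S S' n x : n \in L -> (forall e, 0 <= n e) ->
  S' = [set e | n e != 0] -> S \subset S' -> gale_face S x ->
  0 <= pairing x n /\ (pairing x n = 0 <-> gale_face S' x).
Proof.
move=> nL n0 S'n sSS Fx; have [w [w0 w1 wS xw]] := Fx.
have wn0 i : true -> 0 <= w i * n i by move=> _; rewrite mulr_ge0.
rewrite xw pairing_sum //; split; first by apply: sumr_ge0 => i _; exact: wn0.
split=> [/eqP|[w' [w'0 w'1 w'S xw']]]; last first.
  rewrite -pairing_sum // xw' pairing_sum // big1 // => i _.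
  have [/w'S->|] := boolP (i \in S'); first by rewrite mul0r.
  by rewrite S'n inE negbK => /eqP->; rewrite mulr0.
rewrite psumr_eq0 // => /allP H; exists w; split=> // i; rewrite S'n inE => ni.
by have := H i (mem_index_enum _); rewrite /= mulf_eq0 (negPf ni) orbF => /eqP.
Qed.

(** As a relation it pairs to 1 with every point of the polytope, so constants are pairings there as
    well. *)
Definition ones : {ffun E -> R^o} := [ffun=> 1].

Hypothesis oneL : ones \in L.

Lemma pairing_one S x : gale_face S x -> pairing x ones = 1.
Proof.
case=> w [_ w1 _ ->]; rewrite pairing_sum // -[RHS]w1; apply: eq_bigr => i _.
by rewrite ffunE mulr1.
Qed.

Lemma circL S m : m \in circ S -> m \in L.
Proof. by rewrite memv_cap => /andP[]. Qed.

Lemma gale_face_is_face S S' : cyc S' = S' -> S \subset S' ->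
  is_face (gale_face S) (gale_face S').
Proof.
move=> cS' sSS; have [n nS' [n0 np]] := circ_cyc R cS'.
have nL := circL nS'; have S'n : S' = [set e | n e != 0].
  apply/setP => e; rewrite inE; have [/np/lt0r_neq0->//|] := boolP (e \in S').
  by case/circP: nS' => _ H /H->; rewrite eqxx.
have [l lE] := pairing_lfun (- n).
have lN x : l x = - pairing x n by rewrite lE pairingNr.
exists l, 0; split=> [x Fx|].
  by rewrite lN oppr_le0; case: (pairing_eq0 nL n0 S'n sSS Fx).
apply: classical_sets.eq_set => x; apply: boolp.propext; split.
  move=> F'x; have Fx := gale_face_sub sSS F'x; split=> //=.
  by rewrite lN; have [_ [_ ->]] := pairing_eq0 nL n0 S'n sSS Fx; rewrite ?oppr0.
case=> Fx /= /eqP; rewrite lN oppr_eq0 => /eqP x0.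
by have [_ [H _]] := pairing_eq0 nL n0 S'n sSS Fx; exact: H.
Qed.

(** On the face [c - l] is the pairing with [n = c *: ones - m], known to be nonnegative only off
    [S]. Adding a large multiple of a circulation [p] positive exactly on [S] changes no value on
    [gale_face S] and makes the relation nonnegative; its support is [S']. *)
Lemma is_face_gale_face S F : cyc S = S -> is_face (gale_face S) F ->
  exists S', [/\ cyc S' = S', S \subset S' & F = gale_face S'].
Proof.
move=> cS [l [c [lc FE]]].
have [m mL lm] := pairing_surj l; have [p pS [p0 pp]] := circ_cyc R cS.
have pL := circL pS.
have pS0 e : e \notin S -> p e = 0 by case/circP: pS => _; exact.
pose n : {ffun E -> R^o} := c *: ones - m.
have nL : n \in L by rewrite memvB // memvZ.
have nE e : n e = c - m e by rewrite !ffunE [X in X - _]mulr1.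
have n0 e : e \notin S -> 0 <= n e.
  move=> eS; rewrite nE subr_ge0 -(pairing_coord e mL) -lm.
  exact/lc/gale_face_coord.
(* Large enough that [k * p e] exceeds the absolute value of [n e] for every [e] in [S]; the summand
   1 makes this strict. *)
pose k : R := 1 + \sum_(e in S) `|n e| / p e.
pose n' : {ffun E -> R^o} := n + k *: p.
have n'L : n' \in L by rewrite memvD // memvZ.
have n'E e : n' e = n e + k * p e by rewrite !ffunE.
have n'S e : e \in S -> 0 < n' e.
  move=> eS; rewrite n'E; have pe := pp e eS.
  rewrite -ltrBlDl sub0r; apply: (@le_lt_trans _ _ `|n e|).
    by rewrite -normrN ler_norm.
  rewrite -ltr_pdivrMr // /k (bigD1 e) //= ltr_pwDl // lerDl.
  by apply: sumr_ge0 => i /andP[iS _]; rewrite divr_ge0.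
have n'0 e : 0 <= n' e.
  have [eS|eS] := boolP (e \in S); first exact/ltW/n'S.
  by rewrite n'E pS0 // mulr0 addr0 n0.
pose S' := [set e | n' e != 0]; exists S'.
have sSS : S \subset S' by apply/subsetP => e /n'S; rewrite inE => /lt0r_neq0.
split=> //.
  by apply: cyc_supp n'0; apply/eqP; rewrite -relationsP.
have pn x : gale_face S x -> pairing x n' = c - l x.
  move=> Fx; rewrite /n' !pairingDr pairingNr !pairingZr -lm (pairing_one Fx).
  suff -> : pairing x p = 0 by rewrite mulr0 addr0 mulr1.
  case: Fx => w [_ _ wS ->]; rewrite pairing_sum // big1 // => i _.
  by have [/wS->|/pS0->] := boolP (i \in S); rewrite ?mul0r ?mulr0.
rewrite FE; apply: classical_sets.eq_set => x; apply: boolp.propext; split.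
  case=> Fx /= lx; have [_ [H _]] := pairing_eq0 n'L n'0 erefl sSS Fx.
  by apply: H; rewrite pn // lx subrr.
move=> F'x; have Fx := gale_face_sub sSS F'x; split=> //=.
have [_ [_ /(_ F'x)]] := pairing_eq0 n'L n'0 erefl sSS Fx.
by rewrite pn // => /eqP; rewrite subr_eq0 => /eqP.
Qed.

(** If [e] is in [B] but not in [A], then [beta e] lies in the common face. Pairing with a
    circulation positive exactly on [B] gives 0 on [gale_face B], yet a positive value at
    [beta e]. *)
Lemma gale_face_inj S S' : cyc S = S -> cyc S' = S' ->
  gale_face S = gale_face S' -> S = S'.
Proof.
suff sub A B : cyc B = B -> gale_face A = gale_face B -> B \subset A.
  move=> cS cS' e; apply/eqP; rewrite eqEsubset; apply/andP; split; apply: sub => //.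
move=> cB eAB; apply/subsetP => e eB; apply: contraT => eA.
have [n nB [_ np]] := circ_cyc R cB; have nL := circL nB.
have := gale_face_coord eA; rewrite eAB => -[w [_ _ w0 be]].
have := pairing_coord e nL; rewrite be pairing_sum // big1 => [n0|i _].
  by have := np e eB; rewrite -n0 ltxx.
have [/w0->|] := boolP (i \in B); first by rewrite mul0r.
by case/circP: nB => _ H /H->; rewrite mulr0.
Qed.

Lemma proper_faces_gale_face S : cyc S = S ->
  proper_faces (gale_face S) =
  classical_sets.image
    (fun S' : {set E} => (cyc S' == S') && (S \proper S')) gale_face.
Proof.
move=> cS; apply: classical_sets.eq_set => F; apply: boolp.propext; split.
  case=> /(is_face_gale_face cS)[S' [cS' sSS FS]] nF; exists S' => //.
  rewrite cS' eqxx properEneq sSS andbT /=; apply/eqP => e.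
  by apply: nF; rewrite FS e.
case=> S' /andP[/eqP cS' pS] <-; split.
  by apply: gale_face_is_face => //; exact: proper_sub.
by move/(gale_face_inj cS' cS) => e; move: pS; rewrite e properxx.
Qed.

(** The direction space is the annihilator of the span [M] of [ones] and the circulations on [S]. If
    [S] misses an arc, [M] has dimension [z(S) + 1]; if [S] is everything, the face is empty and the
    formula gives [- 1]. *)
Lemma pdim_gale_face S : pdim (gale_face S) = (nullity [set: E])%:Z - (nullity S)%:Z - 1.
Proof.
have [->|nS] := eqVneq S [set: E].
  by rewrite gale_face_setT pdim_set0 subrr sub0r.
rewrite /pdim; case: eqP => [/(gale_face_neq0 nS)//|_].
have /subsetPn[e _ eS] : ~~ ([set: E] \subset S) by rewrite subTset.
pose M := (circ S + <[ones]>)%VS.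
have sCL : (circ S <= L)%VS by exact: capvSl.
have sML : (M <= L)%VS by rewrite subv_add sCL -memvE.
have dM : \dim M = (nullity S).+1.
  rewrite dimv_disjoint_sum.
    rewrite dim_vline; suff -> : ones != 0 by rewrite addn1.
    by apply/eqP => /ffunP/(_ e)/eqP; rewrite !ffunE oner_eq0.
  apply/eqP; rewrite -subv0; apply/subvP => w; rewrite memv_cap => /andP[/circP[_ wS]].
  case/vlineP=> k wk; have := wS e eS; rewrite wk !ffunE [_ *: _]mulr1 => ->.
  by rewrite scale0r mem0v.
have dA := dim_annihilator sML; rewrite dM in dA.
suff -> : dirspace (gale_face S) = annihilator L M.
  by rewrite /nullity circ_setT -dA addnS -addSn PoszD addrK -addn1 PoszD addrK.
have [dP dmin] := dirspaceP (gale_face S).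
apply/eqP; rewrite eqEsubv; apply/andP; split.
  apply: dmin => x y Fx Fy; apply/annihilatorP => m /memv_addP[q qS [_ /vlineP[k ->] ->]].
  rewrite -/(pairing _ _) pairingB !pairingDr !pairingZr.
  have pq z : gale_face S z -> pairing z q = 0.
    case=> w [_ _ wS ->]; rewrite pairing_sum ?(subvP sCL) // big1 // => i _.
    have [/wS->|] := boolP (i \in S); first by rewrite mul0r.
    by case/circP: qS => _ H /H->; rewrite mulr0.
  by rewrite !pq // (pairing_one Fx) (pairing_one Fy) subrr.
(* A functional vanishing on all directions is the pairing with an [m] constant off [S]; subtracting
   that constant leaves a circulation on [S], so [m] is in [M]. *)
apply/subvP => x /annihilatorP xM; apply: contraT => /separation[l /subvP lU].
have [m mL lm] := pairing_surj l; rewrite lm /pairing => /eqP[]; apply: xM.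
rewrite -(subrK (m e *: ones) m) memv_add ?memvZ ?memv_line //.
apply/circP; split=> [|i iS].
  by apply/eqP; rewrite -relationsP memvB // memvZ.
have := lU _ (dP _ _ (gale_face_coord iS) (gale_face_coord eS)).
rewrite memv_ker lm pairingB !pairing_coord // subr_eq0 => /eqP mie.
by rewrite !ffunE [_ *: _]mulr1 mie subrr.
Qed.

End Faces.

(** * The g-polynomials of the faces *)

Section GaleGpoly.
Variables (R : realType) (V E : finType) (src tgt : E -> V) (u : V).
Variable rev : E -> E.
Hypotheses (rev_inj : injective rev) (src_rev : forall e, src (rev e) = tgt e)
  (tgt_rev : forall e, tgt (rev e) = src e) (conn : spanning src tgt u [set: E]).
Implicit Types (S X : {set E}).

Local Notation cyc := (cyc src tgt).
Local Notation nullity := (nullity R src tgt).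
Local Notation face := (@gale_face R _ _ src tgt).
Local Notation rpoly := (rooted_poly R src tgt u).

(** Reversal pairs each root with its negative. *)
Lemma ones_relation : ones R E \in relations (arc_root R src tgt).
Proof.
rewrite relationsP; under eq_bigr do rewrite ffunE scale1r.
set s := \sum_i _; have : s = - s.
  rewrite {1}/s (reindex_inj rev_inj) -sumrN; apply: eq_bigr => e _ /=.
  by rewrite /arc_root /Defs.root src_rev tgt_rev opprB.
move/eqP; rewrite -addr_eq0 -mulr2n -scaler_nat scaler_eq0 pnatr_eq0 /=.
by [].
Qed.

Lemma cyc_setT : cyc [set: E] = [set: E].
Proof.
apply/setP => e; rewrite mem_cyc !inE /= -src_rev -[src e]tgt_rev.
by apply: reach_arc; rewrite inE.
Qed.

Lemma rooted_poly_setT : rpoly [set: E] = 1.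
Proof.
rewrite /rooted_poly (big_pred1 [set: E]) ?subnn // => X /=.
apply/andP/eqP => [[_ /eqP cX]|->]; last by rewrite cyc_setT conn.
by apply/eqP; rewrite -subTset -cX cyc_sub.
Qed.

(** Induction on the number of arcs outside [S]: proper faces belong injectively to strictly larger
    [S'], so the sum over faces becomes a sum over arc sets. *)
Theorem gpoly_gale_face S : cyc S = S -> gpoly (face S) = rpoly S.
Proof.
move: {2}#|_| (leqnn #|~: S|) => k; elim: k S => [|k IH] S ck cS.
  move: ck; rewrite leqn0 cards_eq0 => /eqP e; rewrite -[S]setCK e setC0.
  by rewrite gale_face_setT gpoly0 rooted_poly_setT.
have [->|nS] := eqVneq S [set: E].
  by rewrite gale_face_setT gpoly0 rooted_poly_setT.
rewrite gpolyE; last exact: gale_face_neq0.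
rewrite hpolyE; last exact: gale_face_neq0.
rewrite -(g_of_h_rooted_poly R u rev_inj src_rev tgt_rev cS nS).
have zT X : (nullity X <= nullity [set: E])%N by apply: nullity_sub; exact: subsetT.
have zS : (nullity S < nullity [set: E])%N.
  by apply: nullity_cyc_lt; [exact: cyc_setT|rewrite properT].
rewrite !(pdim_gale_face ones_relation); congr g_of_h; first by lia.
rewrite proper_faces_gale_face //; last exact: ones_relation.
rewrite fsbigop.fsbig_image; last first.
  move=> S1 S2; rewrite !classical_sets.in_setE => /andP[/eqP c1 _] /andP[/eqP c2 _].
  exact: gale_face_inj.
rewrite [RHS]fsbigop.bigfs ?index_enum_uniq //; last first.
  by move=> S' _; rewrite mem_index_enum.
apply: fsbigop.eq_fsbigr => S'; rewrite classical_sets.in_setE => /andP[/eqP cS' pS'].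
have lt := nullity_cyc_lt R cS' pS'; have le := zT S'.
rewrite IH //; last first.
  rewrite -ltnS; apply: leq_trans ck; apply: proper_card.
  by rewrite properC.
rewrite (pdim_gale_face ones_relation); congr (_ * _ ^+ _); lia.
Qed.

End GaleGpoly.

(** * Acyclic graphs with a unique source *)

Section SubsetSums.
Variables (A : comNzRingType) (E : finType) (x : A).
Implicit Types (B C X Y : {set E}).

Lemma sum_subset_setU B C (P Q : pred {set E}) : [disjoint B & C] ->
  \sum_(X : {set E} | [&& X \subset B :|: C, P (X :&: B) & Q (X :&: C)]) x ^+ #|X| =
  (\sum_(X : {set E} | (X \subset B) && P X) x ^+ #|X|) *
  (\sum_(X : {set E} | (X \subset C) && Q X) x ^+ #|X|).
Proof.
move=> dBC; rewrite big_distrlr /= pair_big /=.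
rewrite (reindex_onto (fun p : {set E} * {set E} => p.1 :|: p.2)
                      (fun X => (X :&: B, X :&: C))) /=; last first.
  by move=> X /and3P[sX _ _]; rewrite -setIUr; exact/setIidPl.
have splitE X Y : X \subset B -> Y \subset C ->
    (X :|: Y) :&: B = X /\ (X :|: Y) :&: C = Y.
  move=> sX sY; rewrite !setIUl (setIidPl sX) (setIidPl sY).
  have XC : X :&: C = set0 by apply/disjoint_setI0; exact: disjointWl dBC.
  have YB : Y :&: B = set0.
    by apply/disjoint_setI0; rewrite disjoint_sym; exact: disjointWr dBC.
  by rewrite XC YB setU0 set0U.
apply: eq_big => [[X Y]|[X Y]] /=.
  apply/andP/idP => [[/and3P[_ HP HQ] /eqP[eX eY]]|].
    have sX : X \subset B by rewrite -eX subsetIr.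
    have sY : Y \subset C by rewrite -eY subsetIr.
    by move: HP HQ; rewrite eX eY sX sY => -> ->.
  move=> /andP[/andP[sX PX] /andP[sY QY]].
  by have [-> ->] := splitE X Y sX sY; rewrite PX QY setUSS // eqxx.
move=> /andP[_ /eqP[eX eY]].
have sX : X \subset B by rewrite -eX subsetIr.
have sY : Y \subset C by rewrite -eY subsetIr.
rewrite -exprD; congr (_ ^+ _).
suff XY : X :&: Y = set0 by rewrite cardsU XY cards0 subn0.
by apply/eqP; rewrite -subset0 -(disjoint_setI0 dBC) setISS.
Qed.

(** The arcs over distinct [j] are chosen independently; a fibre of size [n] contributes
    [(x + 1)^n - 1], the 1 being the excluded empty set. *)
Lemma sum_subset_fibers (V : finType) (f : E -> V) B (J : {set V}) :
  \sum_(X : {set E} | (X \subset [set e in B | f e \in J]) &&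
       [forall j in J, X :&: [set e in B | f e == j] != set0]) x ^+ #|X| =
  \prod_(j in J) ((x + 1) ^+ #|[set e in B | f e == j]| - 1).
Proof.
have one j : \sum_(X : {set E} | (X \subset [set e in B | f e == j]) && (X != set0))
    x ^+ #|X| = (x + 1) ^+ #|[set e in B | f e == j]| - 1.
  have := sum_subsets_expr x (sub0set [set e in B | f e == j]); rewrite setD0 => <-.
  rewrite [X in _ = X - 1](bigD1 set0) /=; last by rewrite !sub0set.
  rewrite setD0 cards0 expr0 addrC addrK; apply: eq_big => X; last by rewrite setD0.
  by rewrite sub0set.
move: {2}#|_| (erefl #|J|) => k; elim: k J => [|k IH] J cJ.
  move/eqP: cJ; rewrite cards_eq0 => /eqP->; rewrite big_set0.
  rewrite (big_pred1 set0) ?cards0 // => X /=.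
  have -> : [set e in B | f e \in set0] = set0 by apply/setP => e; rewrite !inE andbF.
  rewrite subset0; case: eqP => //= _; apply/forall_inP => j; by rewrite inE.
have /set0Pn[j jJ] : J != set0 by rewrite -card_gt0 cJ.
have cJ' : #|J :\ j| = k by move: cJ; rewrite (cardsD1 j) jJ => -[].
rewrite [RHS](bigD1 j) //= -one.
under [X in _ * X]eq_bigl => i do rewrite andbC -in_setD1.
rewrite -(IH _ cJ') -sum_subset_setU; last first.
  rewrite disjoints_subset; apply/subsetP => e; rewrite !inE => /andP[_ /eqP->].
  by rewrite eqxx andbF.
have fJ : [set e in B | f e == j] :|: [set e in B | f e \in J :\ j] =
    [set e in B | f e \in J].
  apply/setP => e; rewrite !inE; case: (e \in B) => //=.
  by case: eqP => //= ->.
apply: eq_bigl => X; rewrite fJ; congr (_ && _).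
have fE i : i \in J :\ j -> X :&: [set e in B | f e \in J :\ j] :&: [set e in B | f e == i] =
    X :&: [set e in B | f e == i].
  move=> iJ; rewrite -setIA; congr (_ :&: _); apply/setIidPr/subsetP => e.
  by rewrite !inE => /andP[-> /eqP->]; rewrite -in_setD1.
apply/forall_inP/andP => [H|[Hj /forall_inP H] i iJ].
  split; first exact: H.
  apply/forall_inP => i iJ; rewrite fE //; apply: H; exact: (subsetP (subD1set J j)).
have [->//|ij] := eqVneq i j; have iJ' : i \in J :\ j by rewrite !inE ij.
by rewrite -fE //; exact: H.
Qed.

End SubsetSums.

Section AcyclicSums.
Variables (V E : finType) (src tgt : E -> V) (u : V).
Implicit Types (X Y : {set E}) (J U : {set V}).

Local Notation reach := (reach src tgt).
Local Notation cyc := (cyc src tgt).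
Local Notation spanning := (spanning src tgt).

Definition inner U : {set E} := [set e | (src e \in U) && (tgt e \in U)].

Definition acyclic_spanning U X :=
  [&& X \subset inner U, cyc X == set0 & [forall v in U, reach X u v]].

(** Counting arcs instead of nullity makes the weight multiplicative over disjoint arc sets; for the
    full vertex set this changes [G] at the empty set only by a power of [t - 1]. *)
Definition acyclic_sum U : {poly int} :=
  \sum_(X : {set E} | acyclic_spanning U X) ('X - 1) ^+ #|X|.

Lemma inner_setT : inner [set: V] = [set: E].
Proof. by apply/setP => e; rewrite !inE. Qed.

Lemma acyclic_spanning_setT X :
  acyclic_spanning [set: V] X = spanning u X && (cyc X == set0).
Proof.
rewrite /acyclic_spanning inner_setT subsetT /= andbC; congr (_ && _).
by apply/forall_inP/spanningP => H v; rewrite ?inE //; apply: H; rewrite inE.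
Qed.

Definition sinks X : {set V} := [set v | (v != u) && [forall e in X, src e != v]].

Lemma sub_sinks X J : u \notin J ->
  reflect (forall e, e \in X -> src e \notin J) (J \subset sinks X).
Proof.
move=> uJ; apply: (iffP subsetP) => [H e eX|H v vJ].
  apply/negP => /H; rewrite inE => /andP[_ /forall_inP/(_ e eX)].
  by rewrite eqxx.
rewrite inE; apply/andP; split; first by apply: contraNneq uJ => <-.
by apply/forall_inP => e eX; apply: contraNneq (H e eX) => ->.
Qed.

(** A vertex [w] other than [u] with the most ancestors is a sink: the target of an arc leaving [w]
    would have all ancestors of [w] and itself besides. That target is not [u], which reaches
    [w]. *)
Lemma sinks_neq0 X v : v != u -> spanning u X -> cyc X = set0 -> sinks X != set0.
Proof.
move=> vu /spanningP RX cX.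
have acyc w w' : reach X w w' -> adjacent src tgt X w' w = false.
  move=> r; apply/negbTE/negP => /adjacentP[e eX [se te]].
  by have := in_set0 e; rewrite -cX mem_cyc eX se te r.
have [w wu wmax] : exists2 w, w != u &
    forall w', w' != u -> (#|[set x | reach X x w']| <= #|[set x | reach X x w]|)%N.
  have [w wu H] := @arg_maxnP _ v (fun w => w != u) (fun w => #|[set x | reach X x w]|) vu.
  by exists w.
apply/set0Pn; exists w; rewrite inE wu; apply/forall_inP => e eX.
apply/negP => /eqP se.
have tu : tgt e != u.
  apply/negP => /eqP tu; have := acyc _ _ (RX w).
  by rewrite -se -tu adjacent_mem.
have := wmax _ tu; rewrite leqNgt => /negP[]; apply: proper_card; apply/properP; split.
  apply/subsetP => x; rewrite !inE => r; apply: reach_trans r _.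
  by rewrite -se; exact: reach_arc.
exists (tgt e); rewrite !inE ?reach0 //; apply/negP => r.
by have := acyc _ _ r; rewrite -se adjacent_mem.
Qed.

Lemma reach_inner X J w v : (forall e, e \in X -> src e \notin J) -> v \notin J ->
  reach X w v -> reach (X :&: inner (~: J)) w v.
Proof.
move=> XJ vJ r.
pose D x := (x \in J) || reach (X :&: inner (~: J)) w x.
have : D v.
  apply: (reach_closed _ r); last by rewrite /D reach0 orbT.
  move=> e eX; rewrite /D (negPf (XJ e eX)) /= => rw.
  have [//|tJ] := boolP (tgt e \in J); apply: reach_trans rw _.
  by apply: reach_arc; rewrite !inE eX (XJ e eX).
by rewrite /D (negPf vJ).
Qed.

(** Sinks are interior to no path and lie on no directed cycle, so acyclicity and reachability off
    [J] concern only the arcs inside the complement, while each [j] in [J] is reached as soon as one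
    arc enters it. *)
Lemma acyclic_spanning_sinks X J : u \notin J ->
  spanning u X && (cyc X == set0) && (J \subset sinks X) =
  [&& X \subset inner (~: J) :|: [set e in [set e | src e \notin J] | tgt e \in J],
      acyclic_spanning (~: J) (X :&: inner (~: J))
    & [forall j in J, (X :&: [set e in [set e | src e \notin J] | tgt e \in J]) :&:
         [set e in [set e | src e \notin J] | tgt e == j] != set0]].
Proof.
move=> uJ; set X0 := X :&: inner (~: J).
have sX0 : X0 \subset X by exact: subsetIl.
apply/andP/and3P => [[/andP[/spanningP RX /eqP cX] /(sub_sinks _ uJ) XJ]|].
  split.
  - apply/subsetP => e eX; rewrite !inE (XJ e eX) /=.
    by rewrite orNb.
  - apply/and3P; split; first exact: subsetIr.
      by rewrite -subset0 -cX cyc_mono.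
    by apply/forall_inP => v; rewrite inE => vJ; exact: reach_inner.
  - apply/forall_inP => j jJ.
    have ju : u != j by apply: contraNneq uJ => ->.
    have nj : ~~ [forall v, v != j] by apply/negP => /forallP/(_ j); rewrite eqxx.
    have RX' : spanning u X by exact/spanningP.
    have [e eX] := spanning_exit (D := fun v => v != j) RX' ju nj.
    move=> /andP[_]; rewrite negbK => /eqP te; apply/set0Pn; exists e.
    by rewrite !inE eX (XJ e eX) te jJ eqxx.
move=> [sX /and3P[_ /eqP cX0 /forall_inP RX0] /forall_inP XJ'].
have XJ e : e \in X -> src e \notin J.
  by move=> eX; have := subsetP sX e eX; rewrite !inE => /orP[|] /andP[].
split; last exact/sub_sinks.
apply/andP; split.
  apply/spanningP => v; have [vJ|vJ] := boolP (v \in J); last first.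
    by apply: reach_sub sX0 _; apply: RX0; rewrite inE.
  have /set0Pn[e] := XJ' v vJ; rewrite !inE => /andP[/andP[eX _] /andP[sJ /eqP te]].
  rewrite -te; apply: reach_trans (reach_arc _ _ eX).
  by apply: reach_sub sX0 _; apply: RX0; rewrite inE.
rewrite -subset0 -cX0; apply/subsetP => e; rewrite !mem_cyc => /andP[eX r].
have r0 := reach_inner XJ (XJ e eX) r.
rewrite r0 andbT !inE eX (XJ e eX) /=; apply/negP => tJ.
(* No arc of [X] leaves [tgt e], so the return walk stays there. *)
have : src e == tgt e.
  apply: (reach_closed (D := fun v => v == tgt e) _ r) => // g gX /eqP sg.
  by have := XJ g gX; rewrite sg tJ.
by move=> /eqP se; have := XJ e eX; rewrite se tJ.
Qed.

(** Each graph has a sink other than [u], so the signs [(-1)^(#|J| - 1)] over the nonempty sets [J]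
    of its sinks add up to 1. Exchanging the sums leaves, for each [J], the graphs in which [J]
    consists of sinks, and their sum factors. *)
Lemma acyclic_sum_rec v : v != u ->
  acyclic_sum [set: V] =
  \sum_(J : {set V} | (J \subset ~: [set u]) && (J != set0))
    (-1) ^+ (#|J| - 1) * acyclic_sum (~: J) *
    \prod_(j in J) ('X^#|[set e | (src e \notin J) && (tgt e == j)]| - 1).
Proof.
move=> vu; pose q : {poly int} := 'X - 1.
have sgn X : spanning u X && (cyc X == set0) ->
    \sum_(J : {set V} | (J \subset sinks X) && (J != set0)) (-1) ^+ (#|J| - 1) = 1 :> {poly int}.
  move=> /andP[RX /eqP cX].
  have := sum_subsets_expr (-1 : {poly int}) (sub0set (sinks X)).
  rewrite addNr expr0n setD0 cards_eq0 (negPf (sinks_neq0 vu RX cX)) /=.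
  rewrite (bigD1 set0) /=; last by rewrite !sub0set.
  rewrite setD0 cards0 expr0 => /addr0_eq H; rewrite -[RHS]opprK [in RHS]H -sumrN.
  apply: eq_big => J; first by rewrite sub0set.
  move=> /andP[_]; rewrite setD0 -card_gt0; case: #|J| => // n _.
  by rewrite subSS subn0 exprS mulN1r opprK.
rewrite /acyclic_sum.
transitivity (\sum_(X : {set E} | acyclic_spanning [set: V] X)
   \sum_(J : {set V} | (J \subset sinks X) && (J != set0)) (-1) ^+ (#|J| - 1) * q ^+ #|X|).
  by apply: eq_bigr => X; rewrite acyclic_spanning_setT => /sgn H; rewrite -mulr_suml H mul1r.
rewrite (exchange_big_dep
  (fun J : {set V} => (J \subset ~: [set u]) && (J != set0))) /=; last first.
  move=> X J _ /andP[sJ ->]; rewrite andbT; apply: subset_trans sJ _.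
  by apply/subsetP => w; rewrite !inE => /andP[].
apply: eq_bigr => J /andP[uJ J0]; rewrite -mulr_sumr -mulrA; congr (_ * _).
have uJ' : u \notin J by move: uJ; rewrite subsetC sub1set inE.
rewrite (eq_bigl _ _ (fun X => congr2 andb (acyclic_spanning_setT X) (erefl _))).
under eq_bigl => X do rewrite J0 andbT acyclic_spanning_sinks //.
rewrite (sum_subset_setU _ _ (fun Y => [forall j in J, Y :&: _ != set0])); last first.
  rewrite disjoints_subset; apply/subsetP => e; rewrite !inE => /andP[_ tJ].
  by rewrite (negPf tJ) andbF.
congr (_ * _).
  apply: eq_bigl => X; rewrite /acyclic_spanning.
  by case: (X \subset _).
rewrite sum_subset_fibers subrK; apply: eq_bigr => j _; congr ('X^_ - 1).
by apply: eq_card => e; rewrite !inE.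
Qed.

End AcyclicSums.

(** * Induced subgraphs *)

Section Embedding.
Variables (V V' E E' : finType) (src tgt : E -> V) (src' tgt' : E' -> V').
Variables (phi : V' -> V) (iota : E' -> E).
Hypotheses (phi_inj : injective phi) (iota_inj : injective iota).
Hypotheses (srcE : forall e, src (iota e) = phi (src' e))
  (tgtE : forall e, tgt (iota e) = phi (tgt' e)).
Hypothesis iota_full : forall e, e \in inner src tgt (phi @: [set: V']) ->
  e \in iota @: [set: E'].

Lemma reach_embedding (X : {set E'}) a b :
  reach src tgt (iota @: X) (phi a) (phi b) = reach src' tgt' X a b.
Proof.
apply/idP/idP => r.
  pose D w := [exists c, (w == phi c) && reach src' tgt' X a c].
  have: D (phi b).
    apply: (reach_closed _ r).
      move=> _ /imsetP[e eX ->] /existsP[c /andP[]]; rewrite srcE => /eqP/phi_inj<- rc.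
      apply/existsP; exists (tgt' e); rewrite tgtE eqxx /=.
      by apply: reach_trans rc _; exact: reach_arc.
    by apply/existsP; exists a; rewrite eqxx reach0.
  by case/existsP=> c /andP[/eqP/phi_inj->].
apply: (reach_closed (D := fun c => reach src tgt (iota @: X) (phi a) (phi c)) _ r).
  move=> e eX rc; apply: reach_trans rc _; rewrite -srcE -tgtE.
  by apply: reach_arc; exact: imset_f.
exact: reach0.
Qed.

Lemma cyc_embedding (X : {set E'}) :
  cyc src tgt (iota @: X) = iota @: cyc src' tgt' X.
Proof.
apply/setP => e; apply/idP/imsetP => [|[e' e'X ->]].
  rewrite mem_cyc => /andP[/imsetP[e' e'X ->]]; rewrite srcE tgtE reach_embedding => r.
  by exists e' => //; rewrite mem_cyc e'X.
move: e'X; rewrite !mem_cyc srcE tgtE reach_embedding => /andP[eX ->].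
by rewrite imset_f.
Qed.

Lemma acyclic_sum_embedding u :
  acyclic_sum src' tgt' u [set: V'] = acyclic_sum src tgt (phi u) (phi @: [set: V']).
Proof.
rewrite /acyclic_sum.
rewrite [RHS](reindex_onto (fun X : {set E'} => iota @: X) (fun X : {set E} => iota @^-1: X)) /=.
  apply: eq_big => [X|X _]; last by rewrite card_imset.
  have -> : iota @^-1: (iota @: X) = X.
    by apply/setP => e; rewrite inE mem_imset.
  rewrite eqxx andbT acyclic_spanning_setT /acyclic_spanning cyc_embedding imset_eq0.
  have -> : iota @: X \subset inner src tgt (phi @: [set: V']).
    by apply/subsetP => _ /imsetP[e _ ->]; rewrite inE srcE tgtE !imset_f ?inE.
  rewrite andbC; congr (_ && _); apply/spanningP/forall_inP => [H _ /imsetP[v _ ->]|H v].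
    by rewrite reach_embedding.
  by rewrite -reach_embedding; apply: H; exact: imset_f.
move=> X /andP[sX _]; apply/setP => e; apply/imsetP/idP => [[e' + ->]|eX].
  by rewrite inE.
have /imsetP[e' _ ee'] := iota_full (subsetP sX e eX).
by exists e' => //; rewrite inE -ee'.
Qed.

End Embedding.

(** * Spanning trees and the passage from nullity to the number of arcs *)

Section Tree.
Variables (R : realType) (V E : finType) (src tgt : E -> V) (u : V).
Local Notation nullity := (nullity R src tgt).
Local Notation spanning := (spanning src tgt).

Lemma nullity_set0 : nullity set0 = 0%N.
Proof.
apply/eqP; rewrite dimv_eq0 -subv0; apply/subvP => m /circP[_ m0].
by rewrite memv0; apply/eqP/ffunP => e; rewrite m0 ?inE // ffunE.
Qed.

(** The tree grows from [u] by arcs leaving the set [C] reached so far; such an arc is the only one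
    across the cut, so the nullity stays 0. *)
Lemma spanning_tree X : spanning u X -> exists Y : {set E},
  [/\ Y \subset X, spanning u Y, nullity Y = 0%N & #|Y| = #|V|.-1].
Proof.
move=> RX.
have V0 : (0 < #|V|)%N by apply/card_gt0P; exists u.
suff H k : (k < #|V|)%N -> exists (C : {set V}) (Y : {set E}),
    [/\ #|C| = k.+1, [/\ #|Y| = k, Y \subset X & nullity Y = 0%N],
        u \in C, forall v, v \in C -> reach src tgt Y u v
      & forall g, g \in Y -> (src g \in C) && (tgt g \in C)].
  have [C [Y [cC [cY YX zY] _ rC _]]] : exists (C : {set V}) (Y : {set E}),
    [/\ #|C| = #|V|.-1.+1, [/\ #|Y| = #|V|.-1, Y \subset X & nullity Y = 0%N],
        u \in C, forall v, v \in C -> reach src tgt Y u v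
      & forall g, g \in Y -> (src g \in C) && (tgt g \in C)] by apply: H; lia.
  exists Y; split=> //; apply/spanningP => v; apply: rC.
  suff -> : C = [set: V] by rewrite inE.
  by apply/eqP; rewrite eqEcard subsetT cardsT cC (prednK V0) leqnn.
elim: k => [|k IH] lt.
  exists [set u], set0; rewrite cards1 cards0 sub0set nullity_set0.
  split; [by []|by []|by rewrite set11|move=> v|by move=> g; rewrite in_set0].
  by rewrite inE => /eqP->; exact: reach0.
have [C [Y [cC [cY YX zY] uC rC CY]]] := IH (ltnW lt).
have nC : ~~ [forall v, v \in C].
  apply/negP => /forallP H; suff : (#|V| <= #|C|)%N by rewrite cC leqNgt lt.
  by rewrite -cardsT; apply: subset_leq_card; apply/subsetP => v _; exact: H.
have [e eX /andP[se te]] := spanning_exit (D := fun v => v \in C) RX uC nC.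
have eY : e \notin Y by apply: contraNN te => /CY/andP[].
exists (tgt e |: C), (e |: Y); split.
- by rewrite cardsU1 te cC.
- split; first by rewrite cardsU1 eY cY.
    by rewrite subUset sub1set eX.
  rewrite -zY; apply: (@nullity_setU1_cut _ _ _ _ _ _ _ (fun v => v \in C)).
    by rewrite se (negPf te).
  by move=> g /CY/andP[-> ->].
- by rewrite inE uC orbT.
- have sY : Y \subset e |: Y by exact: subsetUr.
  move=> v; rewrite !inE => /orP[/eqP->|/rC]; last exact: reach_sub.
  by apply: reach_trans (reach_sub sY (rC _ se)) (reach_arc _ _ (setU11 _ _)).
- move=> g; rewrite !inE => /orP[/eqP->|/CY/andP[-> ->]]; last by rewrite !orbT.
  by rewrite se eqxx orbT.
Qed.

Lemma rooted_poly_set0 :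
  ('X - 1) ^+ #|V|.-1 * rooted_poly R src tgt u set0 = acyclic_sum src tgt u [set: V].
Proof.
rewrite /rooted_poly mulr_sumr /acyclic_sum; apply: eq_big => [X|X /andP[RX _]].
  by rewrite acyclic_spanning_setT.
have [Y [YX RY zY cY]] := spanning_tree RX.
rewrite -exprD nullity_set0 subn0 (nullity_spanning _ RY YX) zY -cY.
by rewrite cardsD (setIidPr YX) add0n subnKC // subset_leq_card.
Qed.

End Tree.

(** * The positions of the root sequence as arcs *)

Section RootIndex.
Variables (V : finType) (r : V -> V -> nat).
Implicit Types (x : root_index r) (i j : V).

Definition root_src x : V := (val (tag x)).1.
Definition root_tgt x : V := (val (tag x)).2.

Definition root_copy x : nat := tagged x.

Definition mk_root i j (ij : i != j) (l : 'I_(r i j)) : root_index r :=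
  existT _ (Sub (i, j) ij : {p : V * V | p.1 != p.2}) l.

Lemma root_index_ind (P : root_index r -> Type) :
  (forall i j ij l, P (@mk_root i j ij l)) -> forall x, P x.
Proof. by move=> H [[[i j] ij] l]; exact: H. Qed.

Lemma root_index_eq x y : root_src x = root_src y -> root_tgt x = root_tgt y ->
  root_copy x = root_copy y -> x = y.
Proof.
case: x => [[[i j] ij] l]; case: y => [[[i' j'] ij'] l'].
rewrite /root_src /root_tgt /root_copy /= => ei ej; subst i' j'.
rewrite (bool_irrelevance ij' ij) in l' * => el.
by congr existT; exact: val_inj.
Qed.

Lemma root_neq x : root_src x != root_tgt x.
Proof. exact: (valP (tag x)). Qed.

Lemma card_roots i j : i != j ->
  #|[set x | (root_src x == i) && (root_tgt x == j)]| = r i j.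
Proof.
move=> ij; rewrite -[RHS]card_ord -(card_imset predT (f := @mk_root i j ij)); last first.
  by move=> l l' /(congr1 (@root_copy)) /= e; exact: val_inj.
apply: eq_card => x; rewrite inE; apply/andP/imsetP => [[/eqP xi /eqP xj]|[l _ ->]].
  move: xi xj; elim/root_index_ind: x => i' j' ij' l; rewrite /root_src /root_tgt /= => ei ej.
  subst i' j'; exists l => //; exact: root_index_eq.
by rewrite /root_src /root_tgt /= !eqxx.
Qed.

Lemma card_roots_from (U : {set V}) j : j \notin U ->
  #|[set x | (root_src x \in U) && (root_tgt x == j)]| = (\sum_(i in U) r i j)%N.
Proof.
move=> jU; rewrite -sum1_card (partition_big root_src (fun i => i \in U)) /=; last first.
  by move=> x; rewrite inE => /andP[].
apply: eq_bigr => i iU; rewrite -card_roots; last by apply: contraNneq jU => <-.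
rewrite sum1_card; apply: eq_card => x; rewrite !inE /=.
by rewrite unfold_in /= inE andbC; case: eqP => //= ->; rewrite iU.
Qed.

End RootIndex.

(** * Root polytopes *)

Section RootPolytope.
Variables (R : realType) (V : finType) (r : V -> V -> nat) (u : V).
Hypotheses (rsym : forall i j, i != j -> r i j = r j i)
  (rpos : forall i j, i != j -> (0 < r i j)%N).

Local Notation src := (@root_src V r).
Local Notation tgt := (@root_tgt V r).

Lemma root_neq_sym (x : root_index r) : tgt x != src x.
Proof. by rewrite eq_sym root_neq. Qed.

(** Copy [l] of a root goes to copy [l] of its negative, which exists by the symmetry of [r]. *)
Definition root_rev (x : root_index r) : root_index r :=
  mk_root (root_neq_sym x) (cast_ord (rsym (root_neq x)) (tagged x)).

Lemma root_rev_inj : injective root_rev.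
Proof.
move=> x y e; apply: root_index_eq.
- exact: (congr1 tgt e).
- exact: (congr1 src e).
- exact: (congr1 (@root_copy _ _) e).
Qed.

Lemma spanning_roots : spanning src tgt u [set: root_index r].
Proof.
apply/spanningP => v; have [->|uv] := eqVneq v u; first exact: reach0.
rewrite eq_sym in uv.
exact: (reach_arc _ _ (in_setT (mk_root uv (Ordinal (rpos uv))))).
Qed.

Lemma gpoly_root_polytope :
  gpoly (root_polytope R r) = rooted_poly R src tgt u set0.
Proof.
have c0 : cyc src tgt set0 = set0 by apply/eqP; rewrite -subset0 cyc_sub.
rewrite -(gpoly_gale_face R root_rev_inj _ _ spanning_roots c0) //.
by rewrite gale_face0.
Qed.

(** On a single vertex there are no arcs, so the empty arc set is the full one and its rooted
    polynomial is 1, in agreement with the convention. *)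
Lemma groot_acyclic_sum :
  ('X - 1) ^+ #|V|.-1 * groot R r = acyclic_sum src tgt u [set: V].
Proof.
rewrite -(rooted_poly_set0 R) /groot; case: eqP => [V1|_]; last by rewrite gpoly_root_polytope.
have -> : set0 = [set: root_index r].
  apply/setP => x; rewrite !inE; apply/esym/negbTE/negP => _.
  have := root_neq x; rewrite (_ : src x = tgt x) ?eqxx //.
  by apply: (fintype_le1P _ _ _); rewrite V1.
by rewrite (rooted_poly_setT R (rev := root_rev)) ?mulr1 //; exact: spanning_roots.
Qed.

End RootPolytope.

Lemma acyclic_sum_restrict (V : finType) (r : V -> V -> nat) (A : {set V}) (u : {x | x \in A}) :
  acyclic_sum (@root_src _ (@restrict_mult V r A)) (@root_tgt _ (@restrict_mult V r A)) u
    [set: {x | x \in A}] =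
  acyclic_sum (@root_src _ r) (@root_tgt _ r) (val u) A.
Proof.
pose r' := @restrict_mult V r A.
have ne (x : root_index r') : val (root_src x) != val (root_tgt x).
  by rewrite (inj_eq val_inj) root_neq.
pose iota (x : root_index r') : root_index r := mk_root (ne x) (tagged x).
have valA : val @: [set: {x | x \in A}] = A.
  apply/setP => v; apply/imsetP/idP => [[w _ ->]|vA]; first exact: valP.
  by exists (Sub v vA).
transitivity (acyclic_sum (@root_src _ r) (@root_tgt _ r) (val u) (val @: [set: {x | x \in A}]));
  last by rewrite valA.
apply: (acyclic_sum_embedding (iota := iota)) => //.
- exact: val_inj.
- move=> x y e; apply: root_index_eq.
  + exact/val_inj/(congr1 (@root_src _ _) e).
  + exact/val_inj/(congr1 (@root_tgt _ _) e).
  + exact: (congr1 (@root_copy _ _) e).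
move=> e; rewrite valA; elim/root_index_ind: e => i j ij l.
rewrite inE /root_src /root_tgt /= => /andP[iA jA].
have ij' : (Sub i iA : {x | x \in A}) != Sub j jA by [].
apply/imsetP; exists (@mk_root _ r' _ _ ij' l) => //.
exact: root_index_eq.
Qed.

(* The vertex set {1, ..., k} is 'I_k, the paper's 1 being the ordinal of value 0. *)
Theorem proposition4p12 (R : realType) (k : nat) (hk : (2 <= k)%N)
    (r : 'I_k -> 'I_k -> nat)
    (rsym : forall i j : 'I_k, i != j -> r i j = r j i)
    (rpos : forall i j : 'I_k, i != j -> (0 < r i j)%N) :
  gpoly (root_polytope R r) =
  \sum_(J : {set 'I_k} |
          (J \subset [set j : 'I_k | (0 < j)%N]) && (J != set0))
    (-1) ^+ (#|J| - 1) * groot R (@restrict_mult 'I_k r (~: J)) *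
    \prod_(j in J) geom_poly (\sum_(i in ~: J) r i j)%N.
Proof.
pose u : 'I_k := Ordinal (ltnW hk); pose v : 'I_k := Ordinal hk.
have vu : v != u by [].
have q0 n : ('X - 1) ^+ n != 0 :> {poly int} by rewrite expf_neq0 // -polyC1 polyXsubC_eq0.
(* After multiplication by this nonzero power of ['X - 1] the left side is an acyclic sum, to which
   the recursion applies. *)
apply: (mulfI (q0 #|'I_k|.-1)).
have k1 : (#|'I_k| == 1%N) = false by rewrite card_ord; apply/eqP; lia.
have -> : ('X - 1) ^+ #|'I_k|.-1 * gpoly (root_polytope R r) =
    acyclic_sum (@root_src _ r) (@root_tgt _ r) u [set: 'I_k].
  by rewrite -(groot_acyclic_sum R u rsym rpos) /groot k1.
rewrite (acyclic_sum_rec _ _ vu) mulr_sumr.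
have uE : [set j : 'I_k | (0 < j)%N] = ~: [set u].
  by apply/setP => j; rewrite !inE lt0n.
rewrite uE; apply: eq_bigr => J /andP[uJ _].
have uJ' : u \in ~: J by move: uJ; rewrite subsetC sub1set.
have := @groot_acyclic_sum R _ (@restrict_mult _ r (~: J)) (Sub u uJ').
rewrite acyclic_sum_restrict /= card_sig => <-; first last.
- by move=> i j ij; apply: rpos; rewrite (inj_eq val_inj).
- by move=> i j ij; apply: rsym; rewrite (inj_eq val_inj).
(* Of the [k - 1] factors, [#|~: J| - 1] go to the g-polynomial on the complement and one to each
   [j] in [J], where [(t - 1) p(n, t) = t^n - 1]. *)
have -> : #|'I_k|.-1 = (#|~: J|.-1 + #|J|)%N.
  have : (0 < #|~: J|)%N by apply/card_gt0P; exists u.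
  by rewrite -(cardsC J); case: #|~: J| => // n _; rewrite addnS addnC.
have -> : \prod_(j in J)
    ('X^#|[set e : root_index r | (root_src e \notin J) && (root_tgt e == j)]| - 1) =
    ('X - 1) ^+ #|J| * \prod_(j in J) geom_poly (\sum_(i in ~: J) r i j)%N.
  rewrite -prodr_const -big_split /=; apply: eq_bigr => j jJ.
  rewrite /geom_poly -subrX1 -card_roots_from ?inE ?negbK //.
  by congr ('X^_ - 1); apply: eq_card => x; rewrite !inE.
rewrite exprD -!mulrA [LHS]mulrCA; congr (_ * _).
by rewrite [RHS]mulrCA; congr (_ * _); exact: mulrCA.
Qed.
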